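(* Let $(X,d)$ be a dendrite and let $f:X\to X$ be a continuous monotone map. Let $M$ be an $\omega$-limit set of $f$, i.e. $M=\omega_f(x)$ for some $x\in X$, and let $[M]$ be its convex hull. Then $M$ belongs to the closure, in $2^X$ with the Hausdorff metric $d_H$, of the set of all periodic orbits of $f$ that are contained in $[M]$.
   Context: A dendrite is a locally connected continuum (compact connected metric space) containing no simple closed curve; any two points $x,y$ of a dendrite are joined by a unique arc $[x,y]$ (with $[x,x]=\{x\}$). A map $f$ is monotone if the preimage of every connected set is connected. $\omega_f(x)=\bigcap_{n\in\mathbb N}\overline{\{f^k(x):k\ge n\}}$. For a nonempty closed $S\subset X$ the convex hull is $[S]=\bigcup_{x,y\in S}[x,y]$. $2^X$ is the set of nonempty closed subsets of $X$, with the Hausdorff metric $d_H(A,B)=\max\{\sup_{x\in A}d(x,B),\sup_{y\in B}d(y,A)\}$. A periodic orbit is a set $\{f^k(p):k\ge 0\}$ with $f^n(p)=p$ for some $n\ge1$; it is regarded as an element of $2^X$. *)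

(* Defs.v *)
From HB Require Import structures.
From mathcomp Require Import all_boot all_order all_algebra.
From mathcomp Require Import all_classical all_reals all_analysis.

Set Implicit Arguments.
Unset Strict Implicit.
Unset Printing Implicit Defensive.

Import Order.TTheory GRing.Theory Num.Theory.
Import numFieldNormedType.Exports.

Local Open Scope classical_set_scope.
Local Open Scope ring_scope.

Section dendrites.
Context {R : realType}.

Definition locally_connected_space (X : topologicalType) : Prop :=
  forall (x : X) (U : set X), nbhs x U ->
    exists V : set X, [/\ open V, V x, connected V & V `<=` U].

(* [f] restricts to a homeomorphism from [A] onto [B], with inverse the
   restriction of [g]; the values outside [A] and [B] are irrelevant *)
Definition homeomorphism_between (T U : topologicalType)
    (A : set T) (B : set U) (f : T -> U) (g : U -> T) : Prop :=
  [/\ {within A, continuous f}, {within B, continuous g},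
      f @` A = B & {in A, cancel f g}].

Definition unit_circle : set (R * R) := [set p | p.1 ^+ 2 + p.2 ^+ 2 = 1].

Definition simple_closed_curve (X : metricType R) (C : set X) : Prop :=
  exists f g, homeomorphism_between unit_circle C f g.

Definition continuum (X : metricType R) : Prop :=
  [/\ [set: X] !=set0, compact [set: X] & connected [set: X]].

Definition dendrite (X : metricType R) : Prop :=
  [/\ continuum X, locally_connected_space X &
      forall C : set X, ~ simple_closed_curve C].

Lemma dendrite_compact (X : metricType R) : dendrite X -> compact [set: X].
Proof. by case=> -[]. Qed.

Definition joining_arc (X : metricType R) (x y : X) (A : set X) : Prop :=
  (x = y /\ A = [set x]) \/
  exists (f : R -> X) (g : X -> R),
    [/\ homeomorphism_between (`[0, 1] : set R) A f g, f 0 = x & f 1 = y].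

(* The arc [x, y]: the unique set satisfying [joining_arc x y]. Existence and
   uniqueness hold in a dendrite; elsewhere the value of [get] is arbitrary. *)
Definition arc_between (X : metricType R) (x y : X) : set X :=
  get (joining_arc x y).

Definition convex_hull (X : metricType R) (S : set X) : set X :=
  \bigcup_(x in S) \bigcup_(y in S) arc_between x y.

End dendrites.

Section dynamics.
Context {X : topologicalType}.
Implicit Type f : X -> X.

Definition monotone_map f : Prop :=
  forall C : set X, connected C -> connected (f @^-1` C).

Definition omega_limit f (x : X) : set X :=
  \bigcap_n closure [set iter k f x | k in [set k | (n <= k)%N]].

Definition periodic_orbit f (P : set X) : Prop :=
  exists (p : X) (n : nat),
    [/\ (0 < n)%N, iter n f p = p & P = [set iter k f p | k in setT]].

End dynamics.

Section hausdorff_distance.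
Context {R : realType} {X : metricType R}.
Implicit Types (x y : X) (A B C : set X).

Definition dist_set x B : R := inf [set mdist x y | y in B].

Definition hausdorff_dist A B : R :=
  Num.max (sup [set dist_set x B | x in A]) (sup [set dist_set y A | y in B]).

Lemma dist_set_ge0 x B : B !=set0 -> 0 <= dist_set x B.
Proof.
move=> [b Bb]; apply: lb_le_inf; first by exists (mdist x b), b.
by move=> _ [y _ <-]; exact: mdist_ge0.
Qed.

Lemma dist_set_le x y B : B y -> dist_set x B <= mdist x y.
Proof.
move=> By; apply: ge_inf; last by exists y.
by exists 0 => _ [z _ <-]; exact: mdist_ge0.
Qed.

Lemma dist_set_lt x B e : B !=set0 -> dist_set x B < e ->
  exists2 y, B y & mdist x y < e.
Proof.
move=> [b Bb] /inf_lt[|_ [y By <-] xye]; last by exists y.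
by exists (mdist x b), b.
Qed.

Lemma dist_set_eq0 x B : B !=set0 -> closed B -> dist_set x B <= 0 -> B x.
Proof.
move=> B0 cB xB; apply: cB => U; rewrite -nbhs_ballE => -[e /= e0 xeU].
have [y By xy] := dist_set_lt B0 (le_lt_trans xB e0).
by exists y; split=> //; apply: xeU; rewrite ballEmdist.
Qed.

Lemma compact_mdist_bounded : compact [set: X] ->
  exists D : R, forall x y, mdist x y <= D.
Proof.
move=> /compact_near_coveringP cX.
have [[a aX]|nX] := EM (exists x : X, True); last first.
  by exists 0 => x; case: nX; exists x.
have [D [_ aD]] : \forall r \near +oo, [set: X] `<=` [set x | mdist a x <= r].
  apply: cX => x _; exists (ball x 1, [set r | mdist a x + 1 <= r]).
    split; first exact: nbhsx_ballx.
    by exists (mdist a x + 1); split; [exact: num_real|move=> r /ltW].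
  move=> [y r] /= []; rewrite ballEmdist /= => xy; apply: le_trans.
  by rewrite (le_trans (metric_triangle a x y))// lerD2l ltW.
exists ((D + 1) + (D + 1)) => x y.
rewrite (le_trans (metric_triangle x a y))// metric_sym.
by apply: lerD; apply: aD => //; rewrite ltrDl.
Qed.

Lemma hausdorff_dist_le A B e : A !=set0 -> B !=set0 ->
    (forall x, A x -> dist_set x B <= e) ->
    (forall y, B y -> dist_set y A <= e) ->
  hausdorff_dist A B <= e.
Proof.
move=> [a Aa] [b Bb] AB BA; rewrite /hausdorff_dist ge_max; apply/andP; split.
- by apply: ge_sup; [exists (dist_set a B), a|move=> _ [x /AB ? <-]].
- by apply: ge_sup; [exists (dist_set b A), b|move=> _ [x /BA ? <-]].
Qed.

Lemma hausdorff_distC A B : hausdorff_dist A B = hausdorff_dist B A.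
Proof. exact: maxC. Qed.

Lemma dist_set_le_hausdorff A B x : compact [set: X] -> B !=set0 -> A x ->
  dist_set x B <= hausdorff_dist A B.
Proof.
move=> /compact_mdist_bounded[D mD] [b Bb] Ax.
rewrite /hausdorff_dist le_max; apply/orP; left.
apply: ub_le_sup; last by exists x.
by exists D => _ [z _ <-]; exact: le_trans (dist_set_le z Bb) (mD _ _).
Qed.

Lemma dist_set_triangle A B C x : compact [set: X] ->
    A !=set0 -> B !=set0 -> C !=set0 -> A x ->
  dist_set x C <= hausdorff_dist A B + hausdorff_dist B C.
Proof.
move=> cX A0 B0 C0 Ax; apply/ler_addgt0Pl => e e0.
have h0 : 0 < e / 2 by rewrite divr_gt0.
have [|y By xy] := @dist_set_lt x B (hausdorff_dist A B + e / 2) B0.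
  by rewrite (le_lt_trans (dist_set_le_hausdorff cX B0 Ax))// ltrDl.
have [|z Cz yz] := @dist_set_lt y C (hausdorff_dist B C + e / 2) C0.
  by rewrite (le_lt_trans (dist_set_le_hausdorff cX C0 By))// ltrDl.
rewrite (le_trans (dist_set_le x Cz))// (le_trans (metric_triangle x y z))//.
by rewrite (le_trans (lerD (ltW xy) (ltW yz)))// addrACA -splitr addrC.
Qed.

End hausdorff_distance.

(* 2^X, for a compact X: the Hausdorff distance is then finite, and a metric *)
Record hyperspace (R : realType) (X : metricType R)
    (cX : compact [set: X]) : Type := Hyperspace {
  hset : set X;
  hsetP : `[< hset !=set0 /\ closed hset >] }.

Section hyperspace_metric.
Context {R : realType} {X : metricType R} {cX : compact [set: X]}.
Local Notation H := (hyperspace cX).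
Implicit Types A B C : H.

HB.instance Definition _ := [isSub for @hset R X cX].
HB.instance Definition _ := [Choice of H by <:].

Let hset0 A : hset A !=set0.
Proof. by have /asboolP[] := hsetP A. Qed.

Let hset_closed A : closed (hset A).
Proof. by have /asboolP[] := hsetP A. Qed.

Definition hmdist A B : R := hausdorff_dist (hset A) (hset B).

Let hmdistxx A : hmdist A A = 0.
Proof.
have [a Aa] := hset0 A; apply/eqP; rewrite eq_le; apply/andP; split.
  by apply: hausdorff_dist_le => // x Ax; rewrite -(mdistxx x) dist_set_le.
exact: le_trans (dist_set_ge0 a (hset0 A)) (dist_set_le_hausdorff cX _ Aa).
Qed.

Let hmdist_positivity A B : hmdist A B = 0 -> A = B.
Proof.
move=> AB0; apply/val_inj/seteqP; split=> x /= Ax; apply: dist_set_eq0 => //.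
- by rewrite -AB0; exact: dist_set_le_hausdorff.
- by rewrite -AB0 /hmdist hausdorff_distC; exact: dist_set_le_hausdorff.
Qed.

Let hmdist_sym A B : hmdist A B = hmdist B A.
Proof. exact: hausdorff_distC. Qed.

Let hmdist_triangle B A C : hmdist A C <= hmdist A B + hmdist B C.
Proof.
apply: hausdorff_dist_le => // x ?; first exact: dist_set_triangle.
rewrite addrC (hmdist_sym A) (hmdist_sym B); exact: dist_set_triangle.
Qed.

HB.instance Definition _ := isMetric.Build R H
  hmdistxx hmdist_positivity hmdist_sym hmdist_triangle.

End hyperspace_metric.

(* Main.v *)
(* Write [segment a b] for the arc from [a] to [b], which is the intersection of
   all connected sets containing [a] and [b], so that a monotone map [f] sends
   [segment a b] into [segment (f a) (f b)].  If [f p = p] and [v] separates both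
   [x] and [iter k f x] from [p], then either the image or the preimage under
   [iter k f] preserves the set [S] of all points that [v] separates from [p].
   Hence, for large [n], an orbit that visits the interior of [S] infinitely often
   along an arithmetic progression of step [n`!] ultimately stays in [S] along it.
   Applied to a fixed point [p] of [f] and to limits [a] <> [b] of pairs of points
   of the same omega-limit sets of [iter n`! f], this contradicts the choice of a
   suitable [v]; so, for some [k], the [k] omega-limit sets of [iter k f] that
   cover [M] are small.  The hull of one of them is a dendrite mapped into itself
   by [iter k f], which has a fixed point there; its orbit is close to [M]. *)
Require Import Defs.
From HB Require Import structures.
From mathcomp Require Import all_boot all_order all_algebra.
From mathcomp Require Import all_classical all_reals all_analysis.
From mathcomp Require Import ring lra.

Set Implicit Arguments.
Unset Strict Implicit.
Unset Printing Implicit Defensive.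

Import Order.TTheory GRing.Theory Num.Theory.
Import numFieldNormedType.Exports.

Local Open Scope classical_set_scope.
Local Open Scope ring_scope.

(** * Paths in locally connected compact metric spaces *)

Section paths.
Context {R : realType}.

(** By the local equivalence, the points of [V] where [P] holds form a relatively open and closed
    subset of [V]. *)
Lemma connected_propagation (T : topologicalType) (V : set T) (P : T -> Prop) :
  connected V -> (forall c, V c -> \forall d \near c, V d -> (P d <-> P c)) ->
  forall a b, V a -> V b -> P a -> P b.
Proof.
move=> cV loc a b Va Vb Pa; suff VP : V `&` P = V by move: Vb; rewrite -VP => -[].
apply: cV; first by exists a.
- exists (interior [set d | V d -> P d]); first exact: open_interior.
  apply/seteqP; split=> [c [Vc Pc]|c [Vc /interior_subset cP]]; last first.
    by split=> //; exact: cP.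
  split=> //; rewrite /interior /=; apply: filterS (loc c Vc) => d dc Vd.
  by apply/(dc Vd).
- exists (~` interior [set d | V d -> ~ P d]).
    by apply: open_closedC; exact: open_interior.
  apply/seteqP; split=> [c [Vc Pc]|c [Vc cP]].
    by split=> // /interior_subset /(_ Vc).
  split=> //; apply: contrapT => nPc; apply: cP.
  rewrite /interior /=; apply: filterS (loc c Vc) => d dc Vd Pd.
  by apply: nPc; apply/(dc Vd).
Qed.

Context {X : metricType R}.
Hypothesis cX : compact [set: X].
Hypothesis lcX : locally_connected_space X.

(** A sequence of points chosen in the sets [F n] has a cluster point, and each closed [F n]
    contains it along with a tail of the sequence. *)
Lemma nested_closed_nonempty (T : topologicalType) (F : nat -> set T) :
  compact [set: T] -> (forall n, closed (F n)) -> (forall n, F n !=set0) ->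
  (forall n, F n.+1 `<=` F n) -> \bigcap_n F n !=set0.
Proof.
move=> cT Fc F0 FS.
have Fle m n : (m <= n)%N -> F n `<=` F m.
  move=> /subnK <-; elim: (n - m)%N => [//|k IH]; rewrite addSn.
  exact: subset_trans (FS _) IH.
have [u Fu] := choice F0.
have [p [_ pu]] := cT (u @ \oo) _ filterT.
exists p => n _; apply: Fc => B /pu pB.
have [|y [Fy By]] := pB (F n); last by exists y.
by exists n => // m /= nm; apply: (Fle _ _ nm).
Qed.

Lemma small_connected_nbhs (V : set X) (c : X) (e : R) :
  open V -> V c -> 0 < e ->
  exists W : set X, [/\ open W, connected W, W c, closure W `<=` V &
    forall x y, W x -> W y -> mdist x y <= e].
Proof.
move=> oV Vc e0.
have /nbhs_ballP[r /= r0 rV] : nbhs c V by exact: open_nbhs_nbhs.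
(* The bound [r / 2] keeps the closure of [W] in the ball of radius [r]; the bound [e / 2] limits
   the diameter to [e]. *)
pose s := Num.min (r / 2) (e / 2).
have s0 : 0 < s by rewrite lt_min !divr_gt0.
have [W [oW Wc cW Ws]] := lcX (nbhsx_ballx c s s0).
have Ws' x : W x -> mdist c x < s by move=> /Ws; rewrite ballEmdist.
exists W; split=> //.
- move=> x Wx; apply: rV; rewrite ballEmdist /=.
  have [|y [Wy xy]] := Wx (ball x s); first exact: nbhsx_ballx.
  move: xy; rewrite ballEmdist /= metric_sym => xy.
  apply: le_lt_trans (metric_triangle c y x) _.
  have := ltrD (Ws' _ Wy) xy => /lt_le_trans; apply.
  by rewrite [leRHS]splitr; apply: lerD; rewrite ge_min lexx.
- move=> x y /Ws' cx /Ws' cy.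
  apply: le_trans (metric_triangle x c y) _; rewrite metric_sym.
  apply: le_trans (ltW (ltrD cx cy)) _.
  by rewrite [leRHS]splitr; apply: lerD; rewrite ge_min lexx orbT.
Qed.

(* A finite chain of links is encoded by sequences over [nat], which are
   constant from index [m] on. *)
Definition chain (e : R) (V : set X) (m : nat) (a b : X)
    (Q : nat -> X) (W : nat -> set X) : Prop :=
  [/\ Q 0%N = a, forall i, (m <= i)%N -> Q i = b &
   forall i, [/\ open (W i), connected (W i), W i (Q i) /\ W i (Q i.+1),
     closure (W i) `<=` V & forall x y, W i x -> W i y -> mdist x y <= e]].

Lemma chain_extend (e : R) (V W' : set X) (m : nat) (a b c : X) Q W :
  chain e V m a b Q W ->
  open W' -> connected W' -> W' b -> W' c -> closure W' `<=` V ->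
  (forall x y, W' x -> W' y -> mdist x y <= e) ->
  exists Q' W', chain e V m.+1 a c Q' W'.
Proof.
move=> [Q0 Qm QW] oW cW W'b W'c W'V W'e.
exists (fun i => if (i <= m)%N then Q i else c),
  (fun i => if (i < m)%N then W i else W'); split=> [//|i mi|i].
  by rewrite leqNgt mi.
case: (ltnP i m) => im; first by have [? ? ? ? ?] := QW i; rewrite (ltnW im).
split=> //; case: ifP => // im'; rewrite Qm//.
Qed.

(** Being joined to [a] by chains of every large length is a locally constant property, since one
    more small link can be appended. All large lengths are asked for, so that finitely many chains
    can be given a common length. *)
Lemma connected_chain (e : R) (V : set X) (a b : X) :
  0 < e -> open V -> connected V -> V a -> V b ->
  exists m0, forall m, (m0 <= m)%N -> exists Q W, chain e V m a b Q W.
Proof.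
move=> e0 oV cV Va Vb.
pose P b := exists m0, forall m, (m0 <= m)%N -> exists Q W, chain e V m a b Q W.
apply: (connected_propagation (P := P) cV _ Va Vb).
  move=> c Vc; have [W' [oW cW W'c W'V W'e]] := small_connected_nbhs oV Vc e0.
  have : nbhs c W' by exact: open_nbhs_nbhs.
  apply: filterS => d W'd _.
  have H x y : W' x -> W' y -> P x -> P y.
    move=> W'x W'y [m0 Pm]; exists m0.+1 => -[//|m] m0m.
    have [Q [W QW]] := Pm m m0m.
    exact: chain_extend QW oW cW W'x W'y W'V W'e.
  by split; exact: H.
have [W' [oW cW W'a W'V W'e]] := small_connected_nbhs oV Va e0.
by exists 0%N => m _; exists (fun=> a), (fun=> W').
Qed.

(* The stages successively refine one another: the links of each cover a
   subdivision of [0, 1] into [stage_len] equal parts, and the path takes [t] to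
   the point common to the closures of the links that correspond to [t]. *)
Record stage (U : set X) (a b : X) := Stage {
  stage_len : nat;
  stage_pt : nat -> X;
  stage_link : nat -> set X;
  stage_len_gt0 : (0 < stage_len)%N;
  stage_start : stage_pt 0%N = a;
  stage_end : forall i, (stage_len <= i)%N -> stage_pt i = b;
  stage_linkP : forall i, [/\ open (stage_link i), connected (stage_link i),
    stage_link i (stage_pt i), stage_link i (stage_pt i.+1) &
    stage_link i `<=` U] }.

Definition stage_refines (U : set X) (a b : X) (e : R) (s s' : stage U a b) :=
  [/\ forall i x y, stage_link s' i x -> stage_link s' i y -> mdist x y <= e &
   exists2 m, (0 < m)%N & stage_len s' = (stage_len s * m)%N /\
    forall i, closure (stage_link s' i) `<=` stage_link s (i %/ m)%N].

(** Each link of [s] is filled with a chain of small links, all chains having the same length [m];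
    the new link [l] is number [l %% m] of chain [l %/ m]. *)
Lemma stage_refinement (U : set X) (a b : X) (e : R) (s : stage U a b) :
  0 < e -> exists s', stage_refines e s s'.
Proof.
move=> e0.
pose N := stage_len s.
(* From index [N] on, all points are [b] and constant chains of any length will do, so that only
   finitely many links constrain [m]. *)
have H i : exists m0, forall m, (m0 <= m)%N \/ (N <= i)%N ->
    exists QW : (nat -> X) * (nat -> set X),
    chain e (stage_link s i) m (stage_pt s i) (stage_pt s i.+1) QW.1 QW.2 /\
    ((N <= i)%N -> forall j, QW.1 j = b).
  have [oV cV Vi Vi1 _] := stage_linkP s i.
  case: (ltnP i N) => iN.
    have [m0 Hm] := connected_chain e0 oV cV Vi Vi1.
    by exists m0 => m -[/Hm[Q [W QW]]|//]; exists (Q, W).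
  exists 0%N => m _.
  have [W' [oW cW W'a W'V W'e]] := small_connected_nbhs oV Vi e0.
  have W'b : W' b by rewrite -(stage_end iN).
  exists (fun=> b, fun=> W'); split=> //=; split=> //=.
  - by rewrite stage_end.
  - by move=> j _; rewrite stage_end// leqW.
have [M HM] := choice H.
pose m := (\max_(i < N) M i).+1.
have {}H i : exists QW : (nat -> X) * (nat -> set X),
    chain e (stage_link s i) m (stage_pt s i) (stage_pt s i.+1) QW.1 QW.2 /\
    ((N <= i)%N -> forall j, QW.1 j = b).
  apply: HM; case: (ltnP i N) => iN; last by right.
  by left; rewrite /m leqW//; exact: (leq_bigmax (Ordinal iN)).
have [QW HQ] := choice H.
pose Q l := (QW (l %/ m)%N).1 (l %% m)%N.
pose W l := (QW (l %/ m)%N).2 (l %% m)%N.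
have N0 : (0 < N * m)%N by rewrite muln_gt0 stage_len_gt0.
have Q0 : Q 0%N = a.
  by rewrite /Q div0n mod0n; have [[-> _ _] _] := HQ 0%N; exact: stage_start.
have Qend l : (N * m <= l)%N -> Q l = b.
  by rewrite -leq_divRL// => lN; rewrite /Q; have [_ ->] := HQ (l %/ m)%N.
have QS l : Q l.+1 = (QW (l %/ m)%N).1 (l %% m).+1.
  have lm : l.+1 = (l %/ m * m + (l %% m).+1)%N by rewrite addnS -divn_eq.
  have := ltn_pmod l (ltn0Sn _ : (0 < m)%N).
  (* At the end of a block, the next point is the start of the following chain, which is also the
     end of the current one. *)
  rewrite leq_eqVlt => /orP[/eqP lm1|lm1].
    rewrite {1}/Q [in LHS]lm lm1 -mulSnr mulnK// modnMl.
    have [[-> _ _] _] := HQ (l %/ m).+1; have [[_ Hb _] _] := HQ (l %/ m)%N.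
    by rewrite Hb// lm1.
  have dS : (l.+1 %/ m = l %/ m)%N by rewrite lm divnMDl// (divn_small lm1) addn0.
  have mS : (l.+1 %% m = (l %% m).+1)%N by rewrite lm modnMDl (modn_small lm1).
  by rewrite {1}/Q dS mS.
have QW' l : [/\ open (W l), connected (W l), W l (Q l), W l (Q l.+1) & W l `<=` U].
  have [[_ _ /(_ (l %% m)%N)[oW cW [Wl Wl1] WV _]] _] := HQ (l %/ m)%N.
  split=> //; first by rewrite QS.
  have [_ _ _ _ VU] := stage_linkP s (l %/ m)%N.
  by apply: subset_trans VU; apply: subset_trans WV; exact: subset_closure.
exists (Stage N0 Q0 Qend QW'); split=> /=.
  by move=> l; have [[_ _ /(_ (l %% m)%N)[_ _ _ _ We]] _] := HQ (l %/ m)%N.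
exists m => //; split=> // l.
by have [[_ _ /(_ (l %% m)%N)[_ _ _ WV _]] _] := HQ (l %/ m)%N.
Qed.


(** Relates the index of the part that contains a parameter in a refined subdivision to its index in
    the coarser one. For negative [x] both sides are 0. *)
Lemma truncn_mulrn_div (x : R) (m : nat) :
  (0 < m)%N -> (Num.truncn (x * m%:R) %/ m)%N = Num.truncn x.
Proof.
move=> m0; have mR : 0 < m%:R :> R by rewrite ltr0n.
have [x0|x0] := leP 0 x; last first.
  have trunc0 (y : R) : y < 0 -> Num.truncn y = 0%N.
    by move=> y0; apply/eqP; rewrite -leqn0 truncn_le_nat (lt_trans y0).
  by rewrite !trunc0 ?div0n// pmulr_llt0.
apply/eqP; rewrite eqn_leq leq_divRL// -ltnS ltn_divLR//.
have /andP[tx xt] := truncn_itv x0.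
rewrite truncn_lt_nat ?mulr_ge0// truncn_ge_nat ?mulr_ge0// !natrM.
by rewrite ltr_pM2r// ler_pM2r// xt tx.
Qed.

(** For parameters less than one part apart: their links are equal or consecutive, and so have a
    common point. *)
Lemma truncn_near (x y : R) : x <= y -> y < x + 1 ->
  Num.truncn y = Num.truncn x \/ Num.truncn y = (Num.truncn x).+1.
Proof.
move=> xy yx1; have le := le_truncn xy.
suff : (Num.truncn y <= (Num.truncn x).+1)%N.
  rewrite leq_eqVlt ltnS => /orP[/eqP->|le']; first by right.
  by left; apply/eqP; rewrite eqn_leq le'.
rewrite truncn_le_nat (lt_trans yx1)// -natr1 ltrD2r; exact: truncnS_gt.
Qed.

(** The closures of the links at [t] are nested with diameters tending to 0, hence have exactly one
    common point. Continuity holds because consecutive links of a fine stage are small and meet. *)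
Lemma path_in_open_connected (U : set X) (a b : X) :
  open U -> connected U -> U a -> U b ->
  exists u : R -> X, [/\ continuous u, u 0 = a, u 1 = b & forall t, U (u t)].
Proof.
move=> oU cU Ua Ub.
have S0end i : (1 <= i)%N -> (fun i => if i == 0%N then a else b) i = b.
  by case: i.
have S0link i : [/\ open U, connected U, U (if i == 0%N then a else b),
    U (if i.+1 == 0%N then a else b) & U `<=` U] by split=> //; case: eqP.
pose S0 : stage U a b := Stage (U := U) (stage_link := fun=> U) (ltn0Sn 0) erefl S0end S0link.
have next (ks : nat * stage U a b) :
    exists s', stage_refines (ks.1.+1%:R^-1) ks.2 s'.
  by apply: stage_refinement; rewrite invr_gt0 ltr0n.
have [g Hg] := choice next.
pose S k := iteri k (fun k s => g (k, s)) S0.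
have SS k : stage_refines k.+1%:R^-1 (S k) (S k.+1) by exact: (Hg (k, S k)).
pose N k := stage_len (S k).
(* Outside [0, 1] the path will be constant: a negative [t] has index 0, and the links of index at
   least [N k] contain [b]. *)
pose V k (t : R) := stage_link (S k) (Num.truncn (t * (N k)%:R)).
have VS k t : closure (V k.+1 t) `<=` V k t.
  have [_ [m m0 [Nm Vm]]] := SS k; apply: subset_trans (Vm _) _.
  by rewrite /V {1}/N Nm natrM mulrA truncn_mulrn_div.
have V0 k t : V k t !=set0.
  have [_ _ ? _ _] := stage_linkP (S k) (Num.truncn (t * (N k)%:R)).
  by exists (stage_pt (S k) (Num.truncn (t * (N k)%:R))).
have V_meet (t : R) : exists x, (\bigcap_k closure (V k t)) x.
  apply: nested_closed_nonempty => //.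
  - by move=> k; exact: closed_closure.
  - by move=> k; have [x ?] := V0 k t; exists x; exact: subset_closure.
  - by move=> k; apply: subset_trans (VS _ _) _; exact: subset_closure.
have [u Hu] := choice V_meet.
have uV k t : V k t (u t) by apply: VS; exact: Hu.
have Vdiam k i x y : stage_link (S k.+1) i x -> stage_link (S k.+1) i y ->
    mdist x y <= k.+1%:R^-1 by have [Vd _] := SS k; exact: Vd.
have ueq t y : (forall k, V k t y) -> u t = y.
  move=> Vy; apply: mdist_positivity; apply/eqP; rewrite eq_le mdist_ge0 andbT.
  apply/ler_addgt0Pl => e e0; rewrite addr0.
  have [k ke] : exists k, k.+1%:R^-1 < e :> R.
    exists (Num.truncn e^-1); rewrite invf_plt ?posrE//; exact: truncnS_gt.
  exact: le_trans (Vdiam k _ _ _ (uV _ _) (Vy _)) (ltW ke).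
exists u; split.
- move=> t; apply/metricType_numDomainType.cvgrPdist_lt => e e0.
  have [k ke] : exists k, k.+1%:R^-1 < e / 2 :> R.
    exists (Num.truncn (e / 2)^-1); rewrite invf_plt ?posrE ?divr_gt0//.
    exact: truncnS_gt.
  have NR : 0 < (N k.+1)%:R :> R by rewrite ltr0n stage_len_gt0.
  have H (x y : R) : x <= y -> y < x + (N k.+1)%:R^-1 -> mdist (u x) (u y) < e.
    move=> xy yx; have := @truncn_near (x * (N k.+1)%:R) (y * (N k.+1)%:R).
    have yx' : y * (N k.+1)%:R < x * (N k.+1)%:R + 1.
      by rewrite -ltr_pdivlMr// mulrDl mulfK ?lt0r_neq0// div1r.
    rewrite ler_pM2r// => /(_ xy yx') Hxy.
    have [p Vp Vp'] : exists2 p, V k.+1 x p & V k.+1 y p.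
      have [_ _ Vi Vi1 _] := stage_linkP (S k.+1) (Num.truncn (x * (N k.+1)%:R)).
      rewrite /V; case: Hxy => ->; first by exists (u x) => //; exact: uV.
      exists (stage_pt (S k.+1) (Num.truncn (x * (N k.+1)%:R)).+1) => //.
      by have [] := stage_linkP (S k.+1) (Num.truncn (x * (N k.+1)%:R)).+1.
    apply: le_lt_trans (metric_triangle _ p _) _; rewrite [ltRHS]splitr.
    by apply: ltrD; apply: le_lt_trans ke; apply: Vdiam; [exact: uV|exact: Vp|
      exact: Vp'|exact: uV].
  near=> y; have [ty|/ltW yt] := leP t y; last rewrite metric_sym.
    by apply: H => //; near: y; apply: lt_nbhsl; rewrite ltrDl invr_gt0.
  apply: H => //; rewrite -ltrBlDr; near: y; apply: lt_nbhsr.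
  by rewrite gtrBl invr_gt0.
- apply: ueq => k; rewrite /V mul0r truncn0.
  by have [_ _ + _ _] := stage_linkP (S k) 0; rewrite stage_start.
- apply: ueq => k; rewrite /V mul1r natrK.
  by have [_ _ + _ _] := stage_linkP (S k) (N k); rewrite stage_end.
- by move=> t; exact: (uV 0%N).
Unshelve. all: by end_near. Qed.

End paths.

(** * Arcs *)

Section quotients.

Lemma within_continuousP (T U : topologicalType) (A : set T) (f : T -> U) :
  {within A, continuous f} <->
  forall x, A x -> forall B, nbhs (f x) B -> \forall y \near x, A y -> B (f y).
Proof.
split=> [cf x Ax B fxB|cf].
  have := cf x B fxB; rewrite nbhs_simpl /=.
  by have [_|//] := nbhs_subspaceP A x; rewrite /within/=.
rewrite continuous_subspace_in => x /set_mem Ax B fxB; rewrite nbhs_simpl /=.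
have [_|//] := nbhs_subspaceP A x; exact: cf.
Qed.

(** Within the image of [K], the preimage of a closed set under [f] is the image by [K] of its
    preimage under [w], a compact set and hence a closed one. *)
Lemma quotient_continuous (T Y Z : topologicalType) (A : set T)
    (K : T -> Y) (w : T -> Z) (f : Y -> Z) :
  hausdorff_space Y -> compact A ->
  {within A, continuous K} -> {within A, continuous w} ->
  (forall t, A t -> f (K t) = w t) -> {within K @` A, continuous f}.
Proof.
move=> hY cA cK cw fK; apply/continuous_closedP => C cC.
move/continuous_closedP: cw => /(_ C cC)/closed_subspaceP[V cV VA].
apply/closed_subspaceP; exists (K @` (V `&` A)).
  apply: compact_closed => //; apply: continuous_compact.
    exact: continuous_subspaceW cK.
  by rewrite setIC; exact: compact_closedI.
rewrite VA; apply/seteqP; split=> [y [[t [wC At] Kt] _]|y [fC [t At Kt]]].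
  by split; [rewrite /from_subspace /= -Kt fK//|exists t].
split; last by exists t.
by exists t => //; split=> //; rewrite /from_subspace /= -fK// Kt.
Qed.

(** A continuous injection of a compact set is a quotient map onto its image, which makes the
    inverse continuous. *)
Lemma injective_homeomorphism (T Y : topologicalType) (t0 : T)
    (A : set T) (f : T -> Y) :
  hausdorff_space Y -> compact A -> {within A, continuous f} ->
  {in A &, injective f} -> exists g, homeomorphism_between A (f @` A) f g.
Proof.
move=> hY cA cf injf.
have /choice[g Hg] y : exists t, (f @` A) y -> A t /\ f t = y.
  by have [[t At ft]|n] := EM ((f @` A) y); [exists t|exists t0 => /n].
have gf t : A t -> g (f t) = t.
  move=> At; have [Ag fg] := Hg (f t) (imageP f At).
  by apply: injf fg; exact: mem_set.
exists g; split=> // [|t /set_mem]; last exact: gf.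
apply: (quotient_continuous (w := id)) cf _ gf => //.
by apply: continuous_subspaceT => ?; exact: cvg_id.
Qed.

End quotients.

(** * Reparametrising a path with convex fibres as an arc *)

Section monotone_fibres.
Context {R : realType} {X : metricType R}.
Hypothesis cX : compact [set: X].
Variable w : R -> X.
Hypothesis cw : {within `[0, 1], continuous w}.
Hypothesis fw : forall r x r', 0 <= r -> r <= x -> x <= r' -> r' <= 1 ->
  w r = w r' -> w x = w r.

(** For [r < q] this is 0, the value of [sup] on the empty set. *)
Let oscillation (q r : R) : R := sup [set mdist (w q) (w x) | x in `[q, r]].

Let oscillation_has_ubound q r :
  has_ubound [set mdist (w q) (w x) | x in `[q, r]].
Proof.
have [D mD] := compact_mdist_bounded cX.
by exists D => _ [x _ <-]; exact: mD.
Qed.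

Let oscillation_ge q r x : q <= x -> x <= r ->
  mdist (w q) (w x) <= oscillation q r.
Proof.
move=> qx xr; apply: ub_le_sup; first exact: oscillation_has_ubound.
by exists x => //; rewrite /= in_itv /= qx.
Qed.

Let oscillation_gt q r : r < q -> oscillation q r = 0.
Proof.
move=> rq; rewrite /oscillation (_ : image _ _ = set0) ?sup0//.
apply/seteqP; split=> // y [x xqr _]; move: xqr; rewrite /= in_itv /= => /andP[qx xr].
by have := le_lt_trans (le_trans qx xr) rq; rewrite ltxx.
Qed.

Let oscillation_ge0 q r : 0 <= oscillation q r.
Proof.
have [qr|/oscillation_gt->//] := leP q r.
by apply: le_trans (oscillation_ge (lexx q) qr); exact: mdist_ge0.
Qed.

Let oscillation_le q r c : 0 <= c ->
  (forall x, q <= x -> x <= r -> mdist (w q) (w x) <= c) -> oscillation q r <= c.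
Proof.
move=> c0 H; have [qr|/oscillation_gt->//] := leP q r.
apply: ge_sup; first by exists (mdist (w q) (w q)), q => //=; rewrite in_itv /= lexx.
move=> _ [x xqr <-]; move: xqr; rewrite /= in_itv /= => /andP[]; exact: H.
Qed.

Let oscillation_mono q r r' : r <= r' -> oscillation q r <= oscillation q r'.
Proof.
move=> rr'; apply: oscillation_le => [|x qx xr]; first exact: oscillation_ge0.
by apply: oscillation_ge => //; exact: le_trans rr'.
Qed.

Let oscillation_step q r r' c : r <= r' -> 0 <= c ->
  (forall x y, r <= x -> x <= r' -> r <= y -> y <= r' -> mdist (w x) (w y) <= c) ->
  oscillation q r' <= oscillation q r + c.
Proof.
move=> rr' c0 H; apply: oscillation_le => [|x qx xr']; first by rewrite addr_ge0// oscillation_ge0.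
have [xr|/ltW rx] := leP x r.
  by apply: le_trans (oscillation_ge qx xr) _; rewrite lerDl.
have [qr|/ltW rq] := leP q r; last first.
  apply: le_trans (_ : c <= _); last by rewrite lerDr.
  by apply: H => //; exact: le_trans xr'.
apply: le_trans (metric_triangle _ (w r) _) _; apply: lerD.
  exact: oscillation_ge.
exact: H.
Qed.

(* [height] is continuous and nondecreasing with the same fibres as [w]: if [w] is
   not constant on [r, r'], the oscillation from some rational of [r, r'] grows. *)
Let rat_seq n : R := if unpickle n is Some x then ratr (x : rat) else 0.

(** Weights of total at most 1 keep these sums bounded, and let them grow no more than the bound on
    the growth of each oscillation. *)
Let height_part N r : R :=
  \sum_(n < N) 2^-1 ^+ n.+1 * oscillation (rat_seq n) r.

Let geometric N : \sum_(n < N) 2^-1 ^+ n.+1 <= 1 :> R.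
Proof.
suff -> : \sum_(n < N) 2^-1 ^+ n.+1 = 1 - 2^-1 ^+ N :> R.
  by rewrite gerBl exprn_ge0.
elim: N => [|N IH]; first by rewrite big_ord0 expr0 subrr.
rewrite big_ord_recr /= IH exprS.
have h : 2^-1 = 1 - 2^-1 :> R by rewrite {2}[1]splitr div1r addrK.
by rewrite {2}h mulrBl mul1r; ring.
Qed.

Let weight_ge0 n : 0 <= 2^-1 ^+ n.+1 :> R. Proof. by rewrite exprn_ge0. Qed.

Let height_part_le N N' r : (N <= N')%N -> height_part N r <= height_part N' r.
Proof.
move=> /subnK <-; elim: (N' - N)%N => [//|k IH]; rewrite addSn.
apply: le_trans IH _; rewrite /height_part [leRHS]big_ord_recr /= lerDl.
exact: mulr_ge0.
Qed.

Let height_part_step N r r' c : r <= r' -> 0 <= c ->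
  (forall x y, r <= x -> x <= r' -> r <= y -> y <= r' -> mdist (w x) (w y) <= c) ->
  height_part N r' <= height_part N r + c.
Proof.
move=> rr' c0 H.
apply: le_trans (_ : height_part N r + (\sum_(n < N) 2^-1 ^+ n.+1) * c <= _).
  rewrite mulr_suml -big_split /=; apply: ler_sum => n _.
  by rewrite -mulrDr ler_wpM2l//; exact: oscillation_step.
by rewrite lerD2l; exact: ler_piMl.
Qed.

Let height_part_gain N n r r' : (n < N)%N -> r <= r' ->
  height_part N r + 2^-1 ^+ n.+1 *
    (oscillation (rat_seq n) r' - oscillation (rat_seq n) r) <= height_part N r'.
Proof.
move=> nN rr'.
have split_term s : height_part N s = 2^-1 ^+ n.+1 * oscillation (rat_seq n) s +
    \sum_(i < N | i != Ordinal nN) 2^-1 ^+ i.+1 * oscillation (rat_seq i) s.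
  by rewrite /height_part (bigD1 (Ordinal nN)).
rewrite !split_term mulrBr.
have : \sum_(i < N | i != Ordinal nN) 2^-1 ^+ i.+1 * oscillation (rat_seq i) r <=
    \sum_(i < N | i != Ordinal nN) 2^-1 ^+ i.+1 * oscillation (rat_seq i) r'.
  by apply: ler_sum => i _; rewrite ler_wpM2l// oscillation_mono.
lra.
Qed.

(** The sum of the series, taken as the supremum of its nondecreasing partial sums. *)
Let height r : R := sup (range (height_part ^~ r)).

Let height_ub r : has_ubound (range (height_part ^~ r)).
Proof.
have [D mD] := compact_mdist_bounded cX.
have D0 : 0 <= D := le_trans (mdist_ge0 (w 0) (w 0)) (mD _ _).
exists D => _ [N _ <-].
apply: le_trans (_ : (\sum_(n < N) 2^-1 ^+ n.+1) * D <= _); last exact: ler_piMl.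
rewrite mulr_suml; apply: ler_sum => n _; rewrite ler_wpM2l//.
by apply: oscillation_le.
Qed.

Let height_part_height N r : height_part N r <= height r.
Proof. by apply: ub_le_sup; [exact: height_ub|exists N]. Qed.

Let height_le r c : (forall N, height_part N r <= c) -> height r <= c.
Proof. by move=> H; apply: ge_sup; [exists (height_part 0 r), 0%N|move=> _ [N _ <-]]. Qed.

(** No term decreases from [r] to [r'], so the growth of the [n]-th oscillation alone is a lower
    bound for that of [height]. *)
Let height_gain n r r' : r <= r' ->
  height r + 2^-1 ^+ n.+1 *
    (oscillation (rat_seq n) r' - oscillation (rat_seq n) r) <= height r'.
Proof.
move=> rr'; rewrite -lerBrDr; apply: height_le => N; rewrite lerBrDr.
apply: le_trans (height_part_height (maxn N n.+1) r').
apply: le_trans (height_part_gain (leq_maxr N n.+1) rr').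
by rewrite lerD2r; apply: height_part_le; exact: leq_maxl.
Qed.

Let height_mono r r' : r <= r' -> height r <= height r'.
Proof.
move=> rr'; apply: le_trans (height_gain 0 rr'); rewrite lerDl mulr_ge0//.
by rewrite subr_ge0 oscillation_mono.
Qed.

Let height_step r r' c : r <= r' -> 0 <= c ->
  (forall x y, r <= x -> x <= r' -> r <= y -> y <= r' -> mdist (w x) (w y) <= c) ->
  height r' <= height r + c.
Proof.
move=> rr' c0 H; apply: height_le => N.
apply: le_trans (height_part_step N rr' c0 H) _.
by rewrite lerD2r; exact: height_part_height.
Qed.

(** If [w r] and [w r'] differ, continuity at [r] gives a rational [q] in []r, r'[] with [w q]
    distinct from [w r']; the oscillation from [q] is 0 at [r] and positive at [r'], so that
    [height] grows. *)
Let height_fibre r r' : 0 <= r -> r <= r' -> r' <= 1 ->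
  height r = height r' -> w r = w r'.
Proof.
move=> r0 rr' r'1 hrr'; apply: contrapT => /eqP; rewrite -mdist_gt0 => d0.
have {}rr' : r < r'.
  by rewrite lt_neqAle rr' andbT; apply: contraTneq d0 => ->; rewrite mdistxx ltxx.
have [e e0 He] : exists2 e, 0 < e & forall x, r < x -> x < r + e -> x <= r' ->
    w x <> w r'.
  have /within_continuousP/(_ r)H := cw.
  have := H _ (ball (w r) (mdist (w r) (w r'))).
  rewrite /= in_itv /= r0 (le_trans (ltW rr') r'1) => /(_ isT).
  move=> /(_ (nbhsx_ballx _ _ d0)) /nbhs_ballP[e /= e0 He].
  exists e => // x rx xr xr' wx; have rex : ball r e x.
    by rewrite /ball /= distrC ger0_norm ?subr_ge0 ?(ltW rx)// ltrBlDl.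
  have := He x rex; rewrite /= in_itv /= (le_trans r0 (ltW rx)) (le_trans xr' r'1) => /(_ isT).
  by rewrite ballEmdist /= wx ltxx.
have rm : r < Num.min r' (r + e) by rewrite lt_min rr' ltrDl.
have [q] := rat_in_itvoo rm.
rewrite in_itv /= lt_min => /and3P[rq qr' qe].
have := height_gain (pickle q) (ltW rr').
rewrite /rat_seq pickleK hrr' gerDl leNgt => /negP; apply.
rewrite mulr_gt0 ?exprn_gt0// (oscillation_gt rq) subr0.
apply: lt_le_trans (oscillation_ge (ltW qr') (lexx r')).
by rewrite mdist_gt0; apply/eqP; apply: He => //; exact: ltW.
Qed.

Let height_const r r' : 0 <= r -> r <= r' -> r' <= 1 ->
  w r = w r' -> height r = height r'.
Proof.
move=> r0 rr' r'1 wrr'; apply/eqP; rewrite eq_le height_mono//=.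
(* By convexity of fibres, [w] is constant on [r, r'], and the growth bound applies with constant
   0. *)
rewrite -[leRHS]addr0; apply: height_step => // x y rx xr' ry yr'.
by rewrite (fw r0 rx xr' r'1 wrr') (fw r0 ry yr' r'1 wrr') mdistxx.
Qed.

Let height_continuous : {within `[0, 1], continuous height}.
Proof.
apply/within_continuousP => x /= x01 B /nbhs_ballP[e /= e0 eB].
(* Values of [w] within [e / 4] of [w x] are within [e / 2] of one another, so that [height] varies
   by less than [e]. *)
have e2 : 0 < e / 2 / 2 by rewrite !divr_gt0.
have /within_continuousP/(_ x x01 _ (nbhsx_ballx _ _ e2)) := cw.
move=> /nbhs_ballP[d /= d0 dw]; apply/nbhs_ballP; exists d => //= y.
rewrite /ball /= => xy; rewrite in_itv /= => y01; apply: eB; rewrite /ball /=.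
move: x01; rewrite in_itv /= => x01.
have H a b : 0 <= a -> b <= 1 -> a <= b -> `|x - a| < d -> `|x - b| < d ->
    height b <= height a + e / 2.
  move=> a0 b1 ab xa xb; apply: height_step => //; first by rewrite divr_ge0// ltW.
  have dx z : a <= z -> z <= b -> mdist (w x) (w z) < e / 2 / 2.
    move=> az zb; have := dw z; rewrite ballEmdist; apply => /=.
      rewrite /ball /= ltr_norml; move: xa xb; rewrite !ltr_norml.
      by move=> /andP[_ xa] /andP[bx _]; apply/andP; split; lra.
    by rewrite in_itv /= (le_trans a0 az) (le_trans zb b1).
  move=> z z' az zb az' z'b; apply: le_trans (metric_triangle _ (w x) _) _.
  rewrite metric_sym [leRHS]splitr; apply: lerD; exact/ltW/dx.
have xx : `|x - x| < d by rewrite subrr normr0.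
have eh : e / 2 < e by rewrite ltr_pdivrMr// ltr_pMr// ltr1n.
move: x01 y01 => /andP[x0 x1] /andP[y0 y1].
have [xy'|/ltW yx'] := leP x y.
  have := H x y x0 y1 xy' xx xy; have := height_mono xy'.
  by move=> h1 h2; rewrite ltr_norml; apply/andP; split; lra.
have := H y x y0 x1 yx' xy xx; have := height_mono yx'.
by move=> h1 h2; rewrite ltr_norml; apply/andP; split; lra.
Qed.

(** Normalised to [K], the height maps [0, 1] onto itself with the same fibres as [w]. Hence [w]
    factors through [K] by an injection [f], built from a section [s] of [K], and [f] is continuous
    because [K] is a quotient map. *)
Lemma arc_of_monotone_fibres : w 0 <> w 1 ->
  joining_arc (w 0) (w 1) (w @` `[0, 1]).
Proof.
move=> w01; right.
have h01 : height 0 < height 1.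
  rewrite lt_neqAle height_mono// andbT; apply/eqP => h; apply: w01.
  exact: height_fibre h.
pose D := height 1 - height 0; have D0 : 0 < D by rewrite subr_gt0.
pose K r := (height r - height 0) / D.
have cK : {within `[0, 1], continuous K}.
  move=> r; apply: cvgMl; apply: cvgB; [exact: height_continuous|exact: cvg_cst].
have K0 : K 0 = 0 by rewrite /K subrr mul0r.
have K1 : K 1 = 1 by rewrite /K divff// lt0r_neq0.
have imK : K @` `[0, 1] = `[0, 1]%classic.
  apply/seteqP; split=> [_ [r r01 <-]|v].
    move: r01; rewrite /= !in_itv /= => /andP[r0 r1].
    rewrite divr_ge0 ?subr_ge0 ?height_mono// ?(ltW D0)//=.
    by rewrite ler_pdivrMr// mul1r lerD2r height_mono.
  rewrite /= in_itv /= => v01; have := IVT (v := v) ler01 cK.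
  rewrite K0 K1 minEle maxEle ler01 => /(_ v01)[r r01 Krv].
  by exists r.
have KE r r' : height r = height r' <-> K r = K r'.
  split=> [h|]; first by rewrite /K h.
  by move=> /mulIf/addIr; apply; rewrite invr_neq0// lt0r_neq0.
have Kfibre r r' : `[0, 1]%classic r -> `[0, 1]%classic r' -> K r = K r' -> w r = w r'.
  rewrite /= !in_itv /= => /andP[r0 r1] /andP[r'0 r'1] /KE.
  have [rr'|/ltW rr'] := leP r r'; first exact: height_fibre.
  by move=> /esym h; apply/esym; exact: height_fibre h.
have Kconst r r' : `[0, 1]%classic r -> `[0, 1]%classic r' -> w r = w r' -> K r = K r'.
  rewrite /= !in_itv /= => /andP[r0 r1] /andP[r'0 r'1] h; apply/KE.
  have [rr'|/ltW rr'] := leP r r'; first exact: height_const.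
  by apply/esym; exact: height_const.
have /choice[s Hs] v : exists r, `[0, 1]%classic v -> `[0, 1]%classic r /\ K r = v.
  have [v01|?] := EM (`[0, 1]%classic v); last by exists 0.
  by move: (v01); rewrite -{1}imK => -[r r01 Krv]; exists r.
pose f v := w (s v).
have Kin r : `[0, 1]%classic r -> `[0, 1]%classic (K r).
  by move=> r01; rewrite -imK; exists r.
have fK r : `[0, 1]%classic r -> f (K r) = w r.
  by move=> r01; have [s01 Ks] := Hs _ (Kin r r01); exact: Kfibre.
have z01 : `[0, 1]%classic (0 : R) by rewrite /= in_itv /= lexx ler01.
have o01 : `[0, 1]%classic (1 : R) by rewrite /= in_itv /= lexx ler01.
have cf : {within `[0, 1], continuous f}.
  rewrite -imK; apply: (quotient_continuous (w := w)) fK => //.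
  exact: segment_compact.
have injf : {in `[0, 1]%classic &, injective f}.
  move=> v v' /set_mem v01 /set_mem v'01 /Kconst.
  have [s01 Ks] := Hs v v01; have [s'01 Ks'] := Hs v' v'01.
  by rewrite Ks Ks'; exact.
have [|g fg] := injective_homeomorphism 0 _ (@segment_compact R 0 1) cf injf.
  exact: metric_hausdorff.
have imf : f @` `[0, 1] = w @` `[0, 1].
  apply/seteqP; split=> [_ [v v01 <-]|_ [r r01 <-]].
    by have [? _] := Hs v v01; exists (s v).
  by rewrite -fK//; exists (K r) => //; exact: Kin.
have := fK _ z01; have := fK _ o01; rewrite K0 K1 => f1 f0.
by exists f, g; split=> //; rewrite -imf.
Qed.

End monotone_fibres.

(** * Erasing the loops of a path *)

Section loop_erasure.
Context {R : realType}.

Lemma closed_last_before (F : set R) (s m : R) : closed F -> F s -> s <= m ->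
  exists p, [/\ F p, s <= p, p <= m & forall r, p < r -> r <= m -> ~ F r].
Proof.
move=> cF Fs sm.
have [|||p /set_mem[]] := @compact_EVT_max R R id (`[s, m] `&` F).
- by exists s; split=> //=; rewrite in_itv /= lexx.
- by apply: compact_closedI => //; exact: segment_compact.
- by apply: continuous_subspaceT => ?; exact: cvg_id.
rewrite /= in_itv /= => /andP[sp pm] Fp pmax; exists p; split=> // r pr rm Fr.
have /pmax : r \in `[s, m]%classic `&` F.
  by apply/mem_set; split=> //=; rewrite in_itv /= rm (le_trans sp (ltW pr)).
by rewrite leNgt pr.
Qed.

Lemma closed_first_after (F : set R) (m t : R) : closed F -> F t -> m <= t ->
  exists p, [/\ F p, m <= p, p <= t & forall r, m <= r -> r < p -> ~ F r].
Proof.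
move=> cF Ft mt.
have [|||p /set_mem[]] := @compact_EVT_min R R id (`[m, t] `&` F).
- by exists t; split=> //=; rewrite in_itv /= lexx andbT.
- by apply: compact_closedI => //; exact: segment_compact.
- by apply: continuous_subspaceT => ?; exact: cvg_id.
rewrite /= in_itv /= => /andP[mp pt] Fp pmin; exists p; split=> // r mr rp Fr.
have /pmin : r \in `[m, t]%classic `&` F.
  by apply/mem_set; split=> //=; rewrite in_itv /= mr (le_trans (ltW rp) pt).
by rewrite leNgt rp.
Qed.

(** The final segments of the chain [C] generate a filter, and compactness gathers the local
    inclusions into an inclusion in a single member. *)
Lemma compact_sub_chain (T : topologicalType) (K : set T) (C : set (set T)) :
  compact K -> C !=set0 -> (forall L, C L -> open L) -> total_on C subset ->
  K `<=` \bigcup_(L in C) L -> exists2 L, C L & K `<=` L.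
Proof.
move=> /compact_near_coveringP cK [L0 CL0] oC totC KC.
pose G := filter_from C (fun L => [set L' | C L' /\ L `<=` L']).
have GP : ProperFilter G.
  apply: filter_from_proper; last by move=> L CL; exists L; split.
  apply: filter_from_filter; first by exists L0.
  move=> L L' CL CL'; have [OO'|L'L] := totC _ _ CL CL'.
    by exists L' => // V [CV L'V]; split=> //; split=> //; exact: subset_trans L'V.
  by exists L => // V [CV OV]; split=> //; split=> //; exact: subset_trans OV.
have : \forall L \near G, K `<=` (fun x => C L /\ L x).
  apply: cK => x /KC[L CL Ox].
  exists (L, [set L' | C L' /\ L `<=` L']) => /=.
    by split; [apply: open_nbhs_nbhs; split=> //; exact: oC|exists L].
  by move=> [y L'] [/= Oy [CL' OO']]; split=> //; exact: OO'.
move=> GK; have GC : \forall L \near G, C L by exists L0 => // L [].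
have [L [CL KL]] := filter_ex (filterI GC GK).
by exists L => // x /KL[].
Qed.

Context {X : metricType R}.
Variable u : R -> X.
Hypothesis cu : continuous u.

(* A union of open intervals such that [u] takes the same value at the ends of
   each of them; a maximal one leaves no loop of [u] outside it. *)
Let removable (L : set R) : Prop :=
  [/\ open L, ~ L 0, ~ L 1 & forall s t, 0 <= s -> s < t -> t <= 1 ->
    ~ L s -> ~ L t -> (forall r, s < r -> r < t -> L r) -> u s = u t].

(** If []s, t[] is a gap of the union, a compact interval [[s', t']] inside it lies in one member
    [L] of the chain. The gap []p, q[] of [L] around it satisfies [u p = u q], with [p] near [s] and
    [q] near [t]; continuity concludes. *)
Let removable_bigcup (C : set (set R)) : C `<=` removable ->
  total_on C subset -> removable (\bigcup_(L in C) L).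
Proof.
move=> CR totC; split.
- by apply: bigcup_open => L /CR[].
- by move=> [L /CR[_ + _ _]].
- by move=> [L /CR[_ _ + _]].
move=> s t s0 st t1 nOs nOt gap; apply: mdist_positivity; apply/eqP.
rewrite eq_le mdist_ge0 andbT; apply/ler_addgt0Pl => e e0; rewrite addr0.
have [d d0 Hd] : exists2 d, 0 < d & forall r, (`|s - r| < d -> mdist (u s) (u r) < e / 2) /\
    (`|t - r| < d -> mdist (u t) (u r) < e / 2).
  have e2 : 0 < e / 2 by rewrite divr_gt0.
  have /nbhs_ballP[d1 /= d10 Hd1] := cu (nbhsx_ballx (u s) _ e2).
  have /nbhs_ballP[d2 /= d20 Hd2] := cu (nbhsx_ballx (u t) _ e2).
  exists (Num.min d1 d2); first by rewrite lt_min d10.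
  move=> r; rewrite !lt_min; split=> /andP[r1 r2].
    by have := Hd1 r r1; rewrite /= ballEmdist.
  by have := Hd2 r r2; rewrite /= ballEmdist.
pose m := (s + t) / 2; have sm : s < m by rewrite midf_lt.
have mt : m < t by rewrite midf_lt.
(* The midpoint [m] ensures that [s' <= m <= t']; [d / 2] brings both ends within [d] of [s] and
   [t]. *)
pose s' := Num.min m (s + d / 2); pose t' := Num.max m (t - d / 2).
have ss' : s < s' by rewrite lt_min sm ltrDl divr_gt0.
have t't : t' < t by rewrite gt_max mt gtrBl divr_gt0.
have [L0 CL0 _] := gap m sm mt.
have [|||L CL KL] := compact_sub_chain (@segment_compact R s' t') _ _ totC.
- by exists L0.
- by move=> L /CR[].
- move=> r /=; rewrite in_itv /= => /andP[s'r rt'].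
  by apply: gap; [exact: lt_le_trans s'r|exact: le_lt_trans t't].
have [oO _ _ gapO] := CR _ CL.
have nOs' : ~ L s by move=> Os; apply: nOs; exists L.
have nOt' : ~ L t by move=> Ot; apply: nOt; exists L.
have Om : L m.
  by apply: KL; rewrite /= in_itv /= ge_min lexx le_max lexx.
have cO : closed (~` L) by exact: open_closedC.
have [p [nOp sp pm pmax]] := closed_last_before cO nOs' (ltW sm).
have [q [nOq mq qt qmin]] := closed_first_after cO nOt' (ltW mt).
have {}pm : p < m by rewrite lt_neqAle pm andbT; apply: contra_notN nOp => /eqP->.
have {}mq : m < q by rewrite lt_neqAle mq andbT; apply: contra_notN nOq => /eqP<-.
have upq : u p = u q.
  apply: gapO => //; [exact: le_trans sp|exact: lt_trans mq|exact: le_trans t1|].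
  move=> r pr rq; apply: contrapT => nOr; have [rm|mr] := leP r m.
    exact: (pmax r pr rm).
  exact: (qmin r (ltW mr) rq).
have ps' : p < s'.
  rewrite ltNge; apply/negP => s'p; apply: nOp; apply: KL.
  by rewrite /= in_itv /= s'p le_max (ltW pm).
have t'q : t' < q.
  rewrite ltNge; apply/negP => qt'; apply: nOq; apply: KL.
  by rewrite /= in_itv /= qt' ge_min (ltW mq).
apply: le_trans (metric_triangle _ (u p) _) _; rewrite {2}upq [leRHS]splitr.
move: ps' t'q; rewrite lt_min gt_max => /andP[_ ps'] /andP[_ t'q].
apply: lerD; first by apply/ltW/(Hd p).1; rewrite ler0_norm ?subr_le0//; lra.
rewrite metric_sym; apply/ltW/(Hd q).2; rewrite ger0_norm ?subr_ge0//; lra.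
Qed.

(** Let [L] be a maximal removable set, and [p r] the last point outside [L] up to [r]; then [w r]
    is [u (p r)]. This freezes [u] along each interval of [L], and maximality makes the fibres of
    [w] convex. *)
Lemma loop_erasure : exists w : R -> X,
  [/\ {within `[0, 1], continuous w}, w 0 = u 0, w 1 = u 1,
      forall r, 0 <= r -> r <= 1 -> exists2 r', 0 <= r' <= 1 & w r = u r' &
      forall r x r', 0 <= r -> r <= x -> x <= r' -> r' <= 1 ->
        w r = w r' -> w x = w r].
Proof.
have [L [[oO nO0 nO1 gapO] maxO]] := Zorn_bigcup removable_bigcup.
have cO : closed (~` L) by exact: open_closedC.
(* Otherwise [L] could be enlarged by []s, t[], against its maximality. *)
have noloop s t : 0 <= s -> s < t -> t <= 1 -> ~ L s -> ~ L t -> u s = u t ->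
    forall r, s < r -> r < t -> L r.
  move=> s0 st t1 nOs nOt ust r sr rt; apply: contrapT => nOr.
  apply: (maxO (L `|` `]s, t[)).
    split; first by move=> ?; left.
    by move=> /(_ r) H; apply/nOr/H; right; rewrite /= in_itv /= sr.
  split; first by apply: openU => //; exact: itv_open.
  - by case=> //=; rewrite in_itv /= ltNge s0.
  - by case=> //=; rewrite in_itv /= [_ < t]ltNge t1 andbF.
  move=> s' t' s'0 s't' t'1 /not_orP[nOs' s's] /not_orP[nOt' t't] gap.
  have {}s's : s < s' -> t <= s'.
    by move=> ss'; rewrite leNgt; apply/negP => s't; apply: s's; rewrite /= in_itv /= ss'.
  have {}t't : s < t' -> t <= t'.
    by move=> st''; rewrite leNgt; apply/negP => t't'; apply: t't; rewrite /= in_itv /= st''.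
  (* A gap that misses []s, t[] is already filled by [L]. Any other gap will be []s, t[] itself,
     since [s] and [t] lie outside the enlarged set. *)
  have outside : (forall x, s' < x -> x < t' -> ~ (s < x /\ x < t)) -> u s' = u t'.
    move=> H; apply: gapO => // x s'x xt'; case: (gap x s'x xt') => // /=.
    by rewrite in_itv /= => /andP[sx xt]; case: (H x s'x xt').
  have [ts'|s't] := leP t s'.
    apply: outside => x s'x _ [_ xt].
    by have := lt_trans (le_lt_trans ts' s'x) xt; rewrite ltxx.
  have [t's|st'] := leP t' s.
    apply: outside => x _ xt' [sx _].
    by have := lt_trans (lt_le_trans xt' t's) sx; rewrite ltxx.
  have s's' : s' <= s.
    by rewrite leNgt; apply/negP => /s's; rewrite leNgt s't.
  have tt' := t't st'.
  have [ss'|s's''] := eqVneq s' s; last first.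
    have : L s \/ `]s, t[%classic s by apply: gap => //; rewrite lt_neqAle s's''.
    by case=> //=; rewrite in_itv /= ltxx.
  have [<-|tt''] := eqVneq t t'; first by rewrite ss'.
  have : L t \/ `]s, t[%classic t.
    by apply: gap; [rewrite ss'|rewrite lt_neqAle tt''].
  by case=> //=; rewrite in_itv /= ltxx andbF.
have /choice[p Hp] r : exists p, 0 <= r -> [/\ ~ L p, 0 <= p, p <= r &
    forall x, p < x -> x <= r -> L x].
  have [r0|r0] := leP 0 r; last by exists 0.
  have [p [nOp p0 pr H]] := closed_last_before cO nO0 r0.
  by exists p => _; split=> // x px xr; apply: contrapT; exact: H.
pose w r := u (p r).
have w0 : w 0 = u 0.
  have [_ p0 p0' _] := Hp 0 (lexx 0); rewrite /w; congr u.
  by apply/eqP; rewrite eq_le p0 p0'.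
have w1 : w 1 = u 1.
  have [_ _ p1 H] := Hp 1 ler01; rewrite /w; congr u.
  apply/eqP; rewrite eq_le p1 leNgt; apply/negP => p1'.
  exact: nO1 (H 1 p1' (lexx 1)).
have pmono r r' : 0 <= r -> r <= r' -> p r <= p r'.
  move=> r0 rr'; have [nOp _ pr _] := Hp r r0.
  have [_ _ _ H] := Hp r' (le_trans r0 rr').
  by rewrite leNgt; apply/negP => pp; apply/nOp/H => //; exact: le_trans rr'.
(* Unless they agree, [w r] and [w r'] are values of [u] at parameters in [r, r'], because [w r] is
   also the value of [u] at the first point [q] outside [L] from [r] on. Continuity of [w] then
   follows from that of [u]. *)
have wu r r' : 0 <= r -> r <= r' -> r' <= 1 -> w r = w r' \/
    exists x x', [/\ r <= x <= r', r <= x' <= r', w r = u x & w r' = u x'].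
  move=> r0 rr' r'1; have r'0 := le_trans r0 rr'.
  have [nOp p0 pr H] := Hp r r0; have [nOp' p'0 p'r' H'] := Hp r' r'0.
  have [rp'|p'r] := leP r (p r'); last first.
    left; rewrite /w; congr u; apply/eqP; rewrite eq_le pmono//=.
    by rewrite leNgt; apply/negP => pp'; apply/nOp'/H => //; exact: ltW.
  right; have [q [nOq rq qp' Hq]] := closed_first_after cO nOp' rp'.
  exists q, (p r'); split=> //; [by rewrite rq (le_trans qp')|by rewrite rp'|].
  rewrite /w; have [->//|pq] := eqVneq (p r) q.
  have {}pq : p r < q by rewrite lt_neqAle pq (le_trans pr).
  apply: gapO => //; first by rewrite (le_trans qp')// (le_trans p'r').
  move=> x px xq; have [xr|/ltW rx] := leP x r; first exact: H.
  by apply: contrapT => nOx; exact: (Hq x rx xq).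
exists w; split=> //.
- apply/within_continuousP => r /=; rewrite in_itv /= => /andP[r0 r1] B.
  move=> /nbhs_ballP[e /= e0 eB]; have e2 : 0 < e / 2 by rewrite divr_gt0.
  have /nbhs_ballP[d /= d0 du] := cu (nbhsx_ballx (u r) _ e2).
  apply/nbhs_ballP; exists d => //= r'; rewrite /ball /= => rr'd.
  rewrite in_itv /= => /andP[r'0 r'1]; apply: eB; rewrite ballEmdist /=.
  have H x x' : `|r - x| < d -> `|r - x'| < d -> mdist (u x) (u x') < e.
    move=> rx rx'; apply: le_lt_trans (metric_triangle _ (u r) _) _.
    rewrite [ltRHS]splitr metric_sym; have := du _ rx; have := du _ rx'.
    by rewrite /= ballEmdist /= => h1 h2; exact: ltrD.
  have [rr'|/ltW r'r] := leP r r'.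
    have [->|[x [x' [/andP[rx xr'] /andP[rx' x'r'] -> ->]]]] := wu r r' r0 rr' r'1.
      by rewrite mdistxx.
    move: rr'd; rewrite !ltr_norml => /andP[h1 h2]; apply: H;
      rewrite ltr_norml; apply/andP; split; lra.
  have [<-|[x [x' [/andP[rx xr'] /andP[rx' x'r'] -> ->]]]] := wu r' r r'0 r'r r1.
    by rewrite mdistxx.
  move: rr'd; rewrite !ltr_norml => /andP[h1 h2]; apply: H;
    rewrite ltr_norml; apply/andP; split; lra.
- move=> r r0 r1; exists (p r) => //; have [_ -> pr _] := Hp r r0.
  exact: le_trans r1.
move=> r x r' r0 rx xr' r'1 ww.
have x0 := le_trans r0 rx; have r'0 := le_trans x0 xr'.
have [nOp p0 pr H] := Hp r r0; have [nOp' p'0 p'r' H'] := Hp r' r'0.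
have [nOx px0 pxx Hx] := Hp x x0.
have := pmono _ _ r0 rx; rewrite le_eqVlt => /orP[/eqP|ppx]; first by rewrite /w => ->.
have := pmono _ _ x0 xr'; rewrite le_eqVlt => /orP[/eqP|pxp].
  by move=> pp; rewrite ww /w pp.
exfalso; apply: nOx; apply: (noloop (p r) (p r')) => //.
  exact: lt_trans pxp.
exact: le_trans r'1.
Qed.

End loop_erasure.

Section arcs.
Context {R : realType} {X : metricType R}.
Hypothesis cX : compact [set: X].
Hypothesis lcX : locally_connected_space X.

(** Erasing the loops of a path in [U] creates no new values, so the resulting arc stays in [U]. *)
Lemma arc_in_open_connected (U : set X) (a b : X) :
  open U -> connected U -> U a -> U b -> a <> b ->
  exists2 A, joining_arc a b A & A `<=` U.
Proof.
move=> oU cU Ua Ub ab.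
have [u [cu u0 u1 uU]] := path_in_open_connected cX lcX oU cU Ua Ub.
have [w [cw w0 w1 wu fw]] := loop_erasure cu.
exists (w @` `[0, 1]).
  by rewrite -u0 -u1 -w0 -w1; apply: arc_of_monotone_fibres; rewrite ?w0 ?w1 ?u0 ?u1.
move=> _ [r r01 <-]; move: r01; rewrite /= in_itv /= => /andP[r0 r1].
by have [r' _ ->] := wu r r0 r1.
Qed.

End arcs.

(** * Simple closed curves and segments *)

Section simple_closed_curves.
Context {R : realType} {X : metricType R}.

Lemma within_continuous_comp (T U V : topologicalType) (A : set T) (B : set U)
    (h : T -> U) (f : U -> V) :
  continuous h -> h @` A `<=` B -> {within B, continuous f} ->
  {within A, continuous (f \o h)}.
Proof.
move=> ch hAB /within_continuousP cf; apply/within_continuousP => x Ax W fW.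
have Bhx : B (h x) by apply: hAB; exists x.
have := ch x _ (cf _ Bhx W fW); rewrite /= nbhs_simpl /=.
by apply: filterS => y fy Ay; apply: fy; apply: hAB; exists y.
Qed.

Lemma unit_circle_bound (p : R * R) : unit_circle p ->
  [/\ -1 <= p.1, p.1 <= 1, -1 <= p.2 & p.2 <= 1].
Proof.
case: p => x y; rewrite /unit_circle /= => xy1.
have x2 := sqr_ge0 x; have y2 := sqr_ge0 y.
have hx : `|x| <= 1 by rewrite -(@ler_pXn2r R 2) ?nnegrE// expr1n real_normK ?num_real//; lra.
have hy : `|y| <= 1 by rewrite -(@ler_pXn2r R 2) ?nnegrE// expr1n real_normK ?num_real//; lra.
by move: hx hy; rewrite !ler_norml => /andP[-> ->] /andP[-> ->].
Qed.

Lemma unit_circle_compact : compact (@unit_circle R).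
Proof.
have K : compact (`[-1, 1]%classic `*` `[-1, 1]%classic : set (R * R)).
  by apply: compact_setX; exact: segment_compact.
apply: subclosed_compact K _.
- rewrite (_ : unit_circle = (fun p : R * R => p.1 ^+ 2 + p.2 ^+ 2) @^-1` [set 1])//.
  apply: preimage_closed; last exact: closed_eq.
  move=> p _; apply: cvgD; rewrite !expr2; apply: cvgM; do ?[exact: cvg_fst|exact: cvg_snd].
- by move=> p /unit_circle_bound[]; rewrite /= !in_itv /= => -> -> -> ->.
Qed.

(** Around [m] there is a largest interval []s, t[] on which [a] avoids the arc [b]. The piece of
    [a] over [s, t] and the piece of [b] with the same ends meet only there, and form the two halves
    of a circle. *)
Lemma simple_closed_curve_of_arcs (a b : R -> X) (m : R) :
  {within `[0, 1], continuous a} -> {in `[0, 1]%classic &, injective a} ->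
  {within `[0, 1], continuous b} -> {in `[0, 1]%classic &, injective b} ->
  a 0 = b 0 -> a 1 = b 1 -> 0 <= m <= 1 -> ~ (b @` `[0, 1]) (a m) ->
  exists C : set X, simple_closed_curve C.
Proof.
move=> ca ia cb ib ab0 ab1 /andP[m0 m1] nam.
have z01 : `[0, 1]%classic (0 : R) by rewrite /= in_itv /= lexx ler01.
have o01 : `[0, 1]%classic (1 : R) by rewrite /= in_itv /= lexx ler01.
pose B := b @` `[0, 1].
have cB : closed B.
  apply: compact_closed; first exact: metric_hausdorff.
  by apply: continuous_compact => //; exact: segment_compact.
pose S := `[0, 1]%classic `&` a @^-1` B.
have cS : closed S.
  move/continuous_closedP: (ca) => /(_ B cB)/closed_subspaceP[V cV VA].
  rewrite /S setIC; have -> : a @^-1` B `&` `[0, 1] = V `&` `[0, 1] by rewrite VA.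
  by apply: closedI => //; exact: itv_closed.
have S0 : S 0 by split=> //; rewrite /= ab0; exists 0.
have S1 : S 1 by split=> //; rewrite /= ab1; exists 1.
have [s [[s01 [s2 s201 bs2]] s0 sm Hs]] := closed_last_before cS S0 m0.
have [t [[t01 [t2 t201 bt2]] mt t1 Ht]] := closed_first_after cS S1 m1.
have Sm : ~ S m by case.
have {}sm : s < m.
  rewrite lt_neqAle sm andbT; apply/eqP => sm'; apply: Sm; rewrite -sm'.
  by split=> //; exists s2.
have {}mt : m < t.
  rewrite lt_neqAle mt andbT; apply/eqP => mt'; apply: Sm; rewrite mt'.
  by split=> //; exists t2.
have st := lt_trans sm mt.
have nS r : s < r -> r < t -> ~ S r.
  move=> sr rt; have [rm|/ltW mr] := leP r m; first exact: Hs.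
  exact: Ht.
have st2 : s2 != t2.
  apply/eqP => e; move: bs2; rewrite e bt2 => /ia.
  by move=> /(_ (mem_set t01) (mem_set s01)) => ts; move: st; rewrite ts ltxx.
(* The abscissa runs affinely from [s] to [t] on the upper half circle, and from [s2] to [t2], in
   whichever order these come, on the lower one. *)
pose ha (p : R * R) := s + (t - s) * ((p.1 + 1) / 2).
pose hb (p : R * R) := s2 + (t2 - s2) * ((p.1 + 1) / 2).
have cha (c d : R) : continuous (fun p : R * R => c + d * ((p.1 + 1) / 2)).
  move=> p; apply: cvgD; first exact: cvg_cst.
  apply: cvgMr; apply: cvgMl; apply: cvgD; [exact: cvg_fst|exact: cvg_cst].
pose phi (p : R * R) := if 0 <= p.2 then a (ha p) else b (hb p).
pose up := unit_circle `&` [set p : R * R | 0 <= p.2].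
pose down := unit_circle `&` [set p : R * R | p.2 <= 0].
have cC : closed (@unit_circle R).
  apply: compact_closed; [exact: norm_hausdorff|exact: unit_circle_compact].
have cup : closed up.
  apply: closedI => //; apply: (@preimage_closed _ _ snd [set y : R | 0 <= y]).
    by move=> p _; exact: cvg_snd.
  exact: closed_ge.
have cdown : closed down.
  apply: closedI => //; apply: (@preimage_closed _ _ snd [set y : R | y <= 0]).
    by move=> p _; exact: cvg_snd.
  exact: closed_le.
have conv (c d : R) (p : R * R) : `[0, 1]%classic c -> `[0, 1]%classic d ->
    unit_circle p -> `[0, 1]%classic (c + (d - c) * ((p.1 + 1) / 2)).
  rewrite /= !in_itv /= => /andP[c0 c1] /andP[d0 d1] /unit_circle_bound[p0 p1 _ _].
  pose x := (p.1 + 1) / 2; have x0 : 0 <= x by rewrite /x; lra.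
  have x1 : x <= 1 by rewrite /x; lra.
  rewrite -/x; apply/andP; split; nra.
have phia p : up p -> phi p = a (ha p) by move=> [_ /=]; rewrite /phi => ->.
have aff0 (c d : R) : c + (d - c) * ((-1 + 1) / 2) = c by lra.
have aff1 (c d : R) : c + (d - c) * ((1 + 1) / 2) = d by lra.
have phib p : down p -> phi p = b (hb p).
  move=> [Cp /= p0]; rewrite /phi; case: leP => // p0'.
  have p20 : p.2 = 0 by apply/eqP; rewrite eq_le p0 p0'.
  move: (Cp); rewrite /unit_circle /= p20 expr0n /= addr0 => /eqP.
  rewrite sqrf_eq1 /ha /hb => /orP[/eqP->|/eqP->].
    by rewrite !aff1 bt2.
  by rewrite !aff0 bs2.
have cphi : {within unit_circle, continuous phi}.
  rewrite (_ : unit_circle = up `|` down); last first.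
    rewrite /up /down -setIUr; apply/esym/setIidPl => p _ /=.
    by have [] := leP 0 p.2; [left|move=> /ltW; right].
  apply: withinU_continuous => //.
  - apply: (@subspace_eq_continuous _ _ _ (a \o ha)).
      by move=> p /set_mem upp; rewrite /from_subspace phia.
    apply: within_continuous_comp ca; first exact: cha.
    by move=> _ [p [Cp _] <-]; exact: conv.
  - apply: (@subspace_eq_continuous _ _ _ (b \o hb)).
      by move=> p /set_mem downp; rewrite /from_subspace phib.
    apply: within_continuous_comp cb; first exact: cha.
    by move=> _ [p [Cp _] <-]; exact: conv.
have affine_inj (c d x y : R) : c != d ->
    c + (d - c) * ((x + 1) / 2) = c + (d - c) * ((y + 1) / 2) -> x = y.
  move=> cd /addrI/mulfI; rewrite subr_eq0 eq_sym => /(_ cd)/mulIf.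
  by rewrite invr_neq0// => /(_ isT)/addIr.
(* A point of the upper half sent into the arc [b] has abscissa -1 or 1. A point of the lower half
   with the same image has the same abscissa, so it cannot lie strictly below the axis. *)
have mixed p q : unit_circle p -> unit_circle q -> 0 <= p.2 -> q.2 < 0 ->
    phi p <> phi q.
  move=> Cp Cq p0 q0; rewrite phia// phib; last by split => //=; exact: ltW.
  move=> pq; have r01 := conv _ _ _ s01 t01 Cp; have q01 := conv _ _ _ s201 t201 Cq.
  have Sr : S (ha p) by split=> //; exists (hb q).
  have [x0 x1 _ _] := unit_circle_bound Cp.
  have q2 : q.1 ^+ 2 <> 1.
    have : 0 < q.2 ^+ 2 by rewrite exprn_even_gt0//= lt_eqF.
    by move=> + q1; move: Cq; rewrite /unit_circle /=; lra.
  have [xe|x0'] := eqVneq p.1 (-1).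
    have hs : ha p = s by rewrite /ha xe aff0.
    move: pq; rewrite hs -bs2 => /ib; rewrite !inE => /(_ s201 q01) e.
    apply: q2; have -> : q.1 = -1; last by rewrite sqrrN expr1n.
    by apply: (affine_inj s2 t2) => //; rewrite -/(hb q) -e aff0.
  have [xe|x1'] := eqVneq p.1 1.
    have ht : ha p = t by rewrite /ha xe aff1.
    move: pq; rewrite ht -bt2 => /ib; rewrite !inE => /(_ t201 q01) e.
    apply: q2; have -> : q.1 = 1; last by rewrite expr1n.
    by apply: (affine_inj s2 t2) => //; rewrite -/(hb q) -e aff1.
  apply: nS Sr; rewrite /ha.
    by rewrite ltrDl mulr_gt0 ?subr_gt0// divr_gt0// -ltrBlDr sub0r lt_neqAle eq_sym x0'.
  rewrite -ltrBrDl gtr_pMr ?subr_gt0// ltr_pdivrMr// mul1r.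
  by rewrite -ltrBrDr; have : p.1 < 1 by [rewrite lt_neqAle x1']; lra.
have injphi : {in unit_circle &, injective phi}.
  move=> p q /set_mem Cp /set_mem Cq pq.
  have same : p.1 = q.1 -> 0 <= p.2 * q.2 -> p = q.
    move: Cp Cq; rewrite /unit_circle /= => Cp Cq pq1 pq2.
    have : p.2 ^+ 2 = q.2 ^+ 2 by move: Cp Cq; rewrite pq1; lra.
    move=> /eqP; rewrite eqf_sqr => /orP[/eqP pq2'|/eqP pq2'].
      by apply: injective_projections.
    have q20 : q.2 = 0.
      apply/eqP; rewrite -sqrf_eq0 eq_le sqr_ge0 andbT expr2.
      by move: pq2; rewrite pq2' mulNr oppr_ge0.
    by apply: injective_projections => //; rewrite pq2' q20 oppr0.
  have [p0|p0] := leP 0 p.2; have [q0|q0] := leP 0 q.2.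
  - apply: same; last exact: mulr_ge0.
    move: pq; rewrite !phia// => /ia; rewrite !inE.
    move=> /(_ (conv _ _ _ s01 t01 Cp) (conv _ _ _ s01 t01 Cq)).
    by apply: affine_inj; rewrite lt_eqF.
  - by case: (mixed p q).
  - by case: (mixed q p).
  - apply: same; last by rewrite mulr_le0 ?ltW.
    move: pq; rewrite !phib; do ?[by split=> //=; exact: ltW].
    move=> /ib; rewrite !inE.
    move=> /(_ (conv _ _ _ s201 t201 Cp) (conv _ _ _ s201 t201 Cq)).
    exact: affine_inj.
have [|g Hg] := injective_homeomorphism (0, 0) _ unit_circle_compact cphi injphi.
  exact: metric_hausdorff.
by exists (phi @` unit_circle), phi, g.
Qed.

End simple_closed_curves.

(** * Arcs of a dendrite as intersections of connected sets *)

Section segments.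
Context {R : realType} {X : metricType R}.

Definition segment (a b : X) : set X :=
  \bigcap_(C in [set C | [/\ connected C, C a & C b]]) C.

Lemma segment_sub (C : set X) a b :
  connected C -> C a -> C b -> segment a b `<=` C.
Proof. by move=> cC Ca Cb x; apply. Qed.

Lemma segment_left a b : segment a b a. Proof. by move=> C []. Qed.

Lemma segment_right a b : segment a b b. Proof. by move=> C []. Qed.

Lemma segmentC a b : segment a b = segment b a.
Proof. by apply/seteqP; split=> x H C [cC Ca Cb]; apply: H. Qed.

Lemma component_open (A : set X) x : locally_connected_space X ->
  open A -> open (connected_component A x).
Proof.
move=> lcX oA; rewrite openE => y Ay.
have /connected_component_sub yA := Ay.
have [V [oV Vy cV VA]] := lcX y A (open_nbhs_nbhs (conj oA yA)).
rewrite /interior; apply: filterS (open_nbhs_nbhs (conj oV Vy)).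
rewrite (same_connected_component Ay); exact: connected_component_max.
Qed.

Hypothesis dX : dendrite X.

Let cX : compact [set: X]. Proof. exact: dendrite_compact. Qed.
Let lcX : locally_connected_space X. Proof. by case: dX. Qed.

Lemma joining_arc_exists (a b : X) : exists A, joining_arc a b A.
Proof.
have [->|/eqP ab] := eqVneq a b; first by exists [set b]; left.
case: dX => -[_ _ conX] _ _.
by have [A ? _] := arc_in_open_connected cX lcX openT conX I I ab; exists A.
Qed.

(** If [C] missed a point [f m] of the arc, it would lie in a component [U] of the complement of
    [f m]. This [U] is open and connected, so it contains an arc from [a] to [b], which forms a
    simple closed curve with part of the given one. *)
Lemma joining_arc_sub (a b : X) (A C : set X) : joining_arc a b A ->
  connected C -> C a -> C b -> A `<=` C.
Proof.
case=> [[-> ->] _ _ Cb x -> //|[f [g [[cf _ <- fK] f0 f1]]]] cC Ca Cb _ [m m01 <-].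
apply: contrapT => nCm; case: (dX) => _ _ nC.
pose U := connected_component (~` [set f m]) a.
have CU : C `<=` U.
  by apply: connected_component_max => // x Cx /= xm; apply: nCm; rewrite -xm.
have oU : open U.
  apply: component_open => //; apply: closed_openC.
  exact/accessible_closed_set1/hausdorff_accessible/metric_hausdorff.
have inj (h : R -> X) k : {in `[0, 1]%classic, cancel h k} ->
    {in `[0, 1]%classic &, injective h} by move=> hK; exact: can_in_inj hK.
have ab : a <> b.
  move=> ab; move: f0 f1; rewrite ab => <- /(inj _ _ fK).
  rewrite !mem_setE !in_itv /= !lexx ler01 => /(_ isT isT)/eqP.
  by rewrite oner_eq0.
have cU : connected U by exact: component_connected.
have [B + BU] := arc_in_open_connected cX lcX oU cU (CU _ Ca) (CU _ Cb) ab.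
case=> [[]//|[h [k [[ch _ hB hK] h0 h1]]]].
have [||||D] := simple_closed_curve_of_arcs (m := m) cf (inj _ _ fK) ch (inj _ _ hK).
- by rewrite f0 h0.
- by rewrite f1 h1.
- by move: m01; rewrite /= in_itv.
- by rewrite hB => /BU/connected_component_sub; apply.
- exact: nC.
Qed.

Lemma joining_arc_segment (a b : X) A : joining_arc a b A ->
  [/\ A = segment a b, connected A & closed A].
Proof.
move=> abA; have [cA clA Aa Ab] : [/\ connected A, closed A, A a & A b].
  case: abA => [[-> ->]|[f [g [[cf _ <- fK] <- <-]]]].
    split=> //; first exact: connected1.
    exact/accessible_closed_set1/hausdorff_accessible/metric_hausdorff.
  split.
  - by apply: connected_continuous_connected => //; exact: segment_connected.
  - apply: compact_closed; first exact: metric_hausdorff.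
    by apply: continuous_compact => //; exact: segment_compact.
  - by exists 0 => //=; rewrite in_itv /= lexx ler01.
  - by exists 1 => //=; rewrite in_itv /= lexx ler01.
split=> //; apply/seteqP; split; last exact: segment_sub.
by move=> x Ax C [cC Ca Cb]; exact: joining_arc_sub abA cC Ca Cb _ Ax.
Qed.

Lemma connected_segment a b : connected (segment a b).
Proof. by have [A /joining_arc_segment[<-]] := joining_arc_exists a b. Qed.

Lemma closed_segment a b : closed (segment a b).
Proof. by have [A /joining_arc_segment[<-]] := joining_arc_exists a b. Qed.

Lemma arc_between_segment a b : arc_between a b = segment a b.
Proof.
by have /getPex/joining_arc_segment[] := joining_arc_exists a b.
Qed.

End segments.

Arguments segment_left {R X} a b.
Arguments segment_right {R X} a b.
Arguments connected_segment {R X} dX a b.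
Arguments closed_segment {R X} dX a b.

(** * Order, fixed points and monotone maps in dendrites *)

Section dendrite_order.
Context {R : realType} {X : metricType R}.
Hypothesis dX : dendrite X.

Let cX : compact [set: X]. Proof. exact: dendrite_compact. Qed.
Let lcX : locally_connected_space X. Proof. by case: dX. Qed.
Implicit Types a b c p v : X.

Let openC1 (x : X) : open (~` [set x]).
Proof. exact/closed_openC/accessible_closed_set1/hausdorff_accessible/metric_hausdorff. Qed.

(** Otherwise the singleton of [x] would be open and closed in [C]. *)
Lemma connected_nonisolated (C N : set X) (x y : X) :
  connected C -> C x -> C y -> x <> y -> nbhs x N ->
  exists z, [/\ C z, N z & z <> x].
Proof.
move=> cC Cx Cy xy xN; apply: contrapT => H; apply: xy.
have CN z : C z -> N z -> z = x.
  by move=> Cz Nz; apply: contrapT => zx; apply: H; exists z.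
have : [set x] = C.
  apply: cC; first by exists x.
  - exists (interior N); first exact: open_interior.
    apply/seteqP; split=> [_ -> //|z [Cz /interior_subset Nz]]; exact: CN.
  - exists [set x]; first by rewrite -openC; exact: openC1.
    by apply/seteqP; split=> [_ -> //|z []].
by move=> xC; move: Cy; rewrite -xC => ->.
Qed.

(** Moving an end of a segment within a small connected set changes the segment only inside that
    set: the source of the local arguments below. *)
Lemma segment_subU (V : set X) a b c :
  connected V -> V b -> V c -> segment a c `<=` segment a b `|` V.
Proof.
move=> cV Vb Vc; apply: segment_sub; last by right.
  apply: connectedU => //; last exact: connected_segment.
  by exists b; split=> //; exact: segment_right.
by left; exact: segment_left.
Qed.

Lemma segment_trans a b c : segment a c `<=` segment a b `|` segment b c.
Proof.
apply: segment_subU; [exact: connected_segment|exact: segment_left|].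
exact: segment_right.
Qed.

Lemma segment_left_sub a b c : segment a b c -> segment a c `<=` segment a b.
Proof.
by move=> abc; apply: segment_sub => //; [exact: connected_segment|exact: segment_left].
Qed.

(** On an arc [f] from [a] to [b] with [c = f t], the segment from [a] to [c] lies in the image of
    [0, t], which contains [b = f 1] only if [t] is 1. *)
Lemma segment_antisym a b c : segment a b c -> segment a c b -> b = c.
Proof.
have [A abA] := joining_arc_exists dX a b.
have [AE _ _] := joining_arc_segment dX abA; rewrite -AE.
case: abA => [[<- -> /= ->]//|[f [g [[cf _ <- fK] f0 f1]]]].
move=> [t t01 <-]; move: (t01); rewrite /= in_itv /= => /andP[t0 t1].
have : segment a (f t) `<=` f @` `[0, t].
  apply: segment_sub.
  - apply: connected_continuous_connected; first exact: segment_connected.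
    apply: continuous_subspaceW cf => r /=; rewrite !in_itv /= => /andP[-> rt].
    exact: le_trans t1.
  - by exists 0 => //=; rewrite in_itv /= lexx t0.
  - by exists t => //=; rewrite in_itv /= lexx t0.
move=> sub /sub[r]; rewrite /= in_itv /= => /andP[r0 rt]; rewrite -f1 => fr.
have r1 := le_trans rt t1.
have : r = 1 by rewrite -(fK r) ?fr ?fK// inE /= in_itv /= ?ler01 ?lexx// r0.
by move=> r1'; congr f; apply/eqP; rewrite eq_le t1 -r1' rt.
Qed.

(** If [w] is off the segment from [a] to [b], let [V] be a connected neighbourhood of [b] whose
    closure misses [w]. For all ends in [V], the segment stays in the closed union of that closure
    and the original segment. *)
Lemma closed_segment_relation a : closed [set wb : X * X | segment a wb.2 wb.1].
Proof.
rewrite -openC openE => -[w b] /= nabw.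
have wb : b <> w by move=> bw; apply: nabw; rewrite -bw; exact: segment_right.
have [V [oV cV Vb Vw _]] := small_connected_nbhs lcX (openC1 w) wb ltr01.
pose U := ~` (closure V `|` segment a b).
have oU : open U.
  by apply/closed_openC/closedU; [exact: closed_closure|exact: closed_segment].
have Uw : U w by case=> // /Vw; exact.
exists (U, V); first by split; exact: open_nbhs_nbhs.
move=> [w' b'] [/= Uw' Vb'] abw'; apply: Uw'.
have [|Vw'] := segment_subU (a := a) cV Vb Vb' abw'; first by right.
by left; exact: subset_closure.
Qed.

(* The part of the dendrite that [v] separates from [p], together with [v] *)
Definition shadow (p v : X) : set X := [set w | segment p w v].

Lemma shadow_closed p v : closed (shadow p v).
Proof.
apply: (@preimage_closed _ _ (fun w => (v, w)) [set wb : X * X | segment p wb.2 wb.1]).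
  by move=> w _; apply: cvg_pair; [exact: cvg_cst|exact: cvg_id].
exact: closed_segment_relation.
Qed.

(** It is the union of the segments from [v] to its points: if [u] is on such a segment to [w] and
    [v] is not between [p] and [u], then [v] is between [u] and [w], and antisymmetry gives
    [u = v]. *)
Lemma shadow_connected p v : connected (shadow p v).
Proof.
rewrite (_ : shadow p v = \bigcup_(w in shadow p v) segment v w).
  apply: bigcup_connected; last by move=> w _; exact: connected_segment.
  by exists v => w _; exact: segment_left.
apply/seteqP; split=> [w pwv|u [w pwv vwu]].
  by exists w => //; exact: segment_right.
have pwu : segment p w u.
  rewrite segmentC; apply: (@segment_left_sub w p v); rewrite segmentC//.
rewrite /shadow /=; have [//|uwv] := segment_trans u pwv.
have -> : v = u by apply: (@segment_antisym w); rewrite segmentC.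
exact: segment_right.
Qed.

(** For [w] in a connected neighbourhood of [a] that misses [v], the segment from [p] to [w] must
    still pass through [v]. *)
Lemma shadow_nbhs p v a : segment p a v -> v <> a -> nbhs a (shadow p v).
Proof.
move=> pav va; have av : a <> v by move=> e; exact: va.
have [V [oV cV Va Vv _]] := small_connected_nbhs lcX (openC1 v) av ltr01.
apply: filterS (open_nbhs_nbhs (conj oV Va)) => w Vw.
have [//|/subset_closure/Vv] := segment_subU (a := p) cV Vw Va pav.
by move=> /(_ erefl).
Qed.

(* [g] fixes any maximal [w] among the points that it moves away from [a]. *)
Lemma dendrite_fixed_point (Y : set X) (g : X -> X) :
  closed Y -> Y !=set0 -> (forall x y, Y x -> Y y -> segment x y `<=` Y) ->
  continuous g -> (forall x, Y x -> Y (g x)) -> exists2 w, Y w & g w = w.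
Proof.
move=> cY [a Ya] convY cg gY.
pose L := Y `&` [set w | segment a (g w) w].
have cL : closed L.
  apply: closedI => //.
  apply: (@preimage_closed _ _ (fun w => (w, g w)) [set wb : X * X | segment a wb.2 wb.1]).
    by move=> w _; apply: cvg_pair; [exact: cvg_id|exact: cg].
  exact: closed_segment_relation.
have La : L a by split=> //; exact: segment_left.
pose T := {w : X | L w}.
(* The order of the dendrite rooted at [a]. *)
pose r (s t : T) := `[< segment a (sval t) (sval s) >].
have rtrans s t u : r s t -> r t u -> r s u.
  by move=> /asboolP st /asboolP tu; apply/asboolP; exact: segment_left_sub st.
have [||||[w [Yw Lw]] wmax] := @Zorn T r.
- by move=> t; apply/asboolP; exact: segment_right.
- by move=> s t u; exact: rtrans.
- move=> [s Ls] [t Lt] /asboolP st /asboolP ts; apply: eq_exist.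
  by apply/esym; exact: segment_antisym st ts.
- move=> A totA; have [[c0 Ac0]|nA] := EM (A !=set0); last first.
    by exists (exist _ a La) => s As; case: nA; exists s.
  (* A cluster point of the final segments of the chain [A] is an upper bound, because shadows are
     closed. *)
  pose G := filter_from A (fun c : T => [set w | exists2 s, A s /\ r c s & sval s = w]).
  have GP : ProperFilter G.
    apply: filter_from_proper; last first.
      move=> c Ac; exists (sval c), c => //; split=> //.
      by apply/asboolP; exact: segment_right.
    apply: filter_from_filter; first by exists c0.
    move=> c c' Ac Ac'; have [cc'|c'c] := totA _ _ Ac Ac'.
      by exists c' => // _ [s [As c's] <-]; split; exists s => //; split=> //; exact: rtrans c's.
    by exists c => // _ [s [As cs] <-]; split; exists s => //; split=> //; exact: rtrans cs.
  have [w [_ Gw]] := cX GP filterT.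
  have Lw : L w.
    apply: cL => B wB; have GL : G L by exists c0 => // _ [[s Ls] _ <-].
    exact: Gw.
  exists (exist _ w Lw) => s As; apply/asboolP => /=.
  apply: shadow_closed => B wB.
  have Gs : G (shadow a (sval s)).
    by exists s => // _ [t [_ /asboolP st] <-].
  exact: Gw.
exists w => //; apply: contrapT => gw.
(* A point [w'] between [w] and [g w], close enough to [w] for [g w'] to be in [V] and [w'] outside
   its closure, is still moved away from [a] and exceeds [w]. *)
have [V [oV cV Vgw Vw _]] := small_connected_nbhs lcX (openC1 w) gw ltr01.
have wN : nbhs w (g @^-1` V `&` ~` closure V).
  apply: filterI; first exact: cg (open_nbhs_nbhs (conj oV Vgw)).
  apply: open_nbhs_nbhs; split; first exact/closed_openC/closed_closure.
  by move=> /Vw; exact.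
have [w' [w'wg [Vgw' nVw'] w'w]] := connected_nonisolated (connected_segment dX w (g w))
  (segment_left _ _) (segment_right _ _) (fun e => gw (esym e)) wN.
have aw' : segment a (g w) w'.
  rewrite segmentC; apply: (segment_left_sub (c := w)); first by rewrite segmentC.
  by rewrite segmentC.
have Yw' : Y w' by apply: convY aw' => //; exact: gY.
have Lw' : L w'.
  split=> //=; have [//|/subset_closure//] := segment_subU (a := a) cV Vgw' Vgw aw'.
have : r (exist _ w (conj Yw Lw)) (exist _ w' Lw').
  apply/asboolP => /=; have [//|w'gw] := segment_trans w' Lw.
  case: w'w; apply/esym; apply: (@segment_antisym (g w)); first by rewrite segmentC.
  by rewrite segmentC.
by move=> /wmax[].
Qed.

Lemma segment_monotone (h : X -> X) a b x : monotone_map h ->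
  segment a b x -> segment (h a) (h b) (h x).
Proof.
move=> mh abx; have /mh cS : connected (segment (h a) (h b)) by exact: connected_segment.
by apply: (segment_sub cS) abx; [exact: segment_left|exact: segment_right].
Qed.

(** If [v] separates [h v] from [p], the shadow is mapped into itself. Otherwise the preimage of the
    shadow, a connected set containing [y], misses [v]; a point of it outside the shadow would have
    [v] between itself and [y]. *)
Lemma shadow_invariant (h : X -> X) p v : monotone_map h -> h p = p ->
  (exists2 x, shadow p v x & shadow p v (h x)) ->
  (forall x, shadow p v x -> shadow p v (h x)) \/
  (forall x, shadow p v (h x) -> shadow p v x).
Proof.
move=> mh hp [y Sy Shy]; have [pvv|npvv] := EM (segment p (h v) v).
  left=> x pxv; have := segment_monotone mh pxv; rewrite hp => phxv.
  exact: segment_left_sub phxv _ pvv.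
right=> x Shx; have [//|xyv] := segment_trans x Sy; case: npvv.
have cW : connected (h @^-1` shadow p v) by exact/mh/shadow_connected.
exact: (segment_sub cW Shx Shy xyv).
Qed.

Lemma hull_from (S : set X) a : S a ->
  convex_hull S = \bigcup_(b in S) segment a b.
Proof.
move=> Sa; apply/seteqP; split=> [x [b Sb [c Sc]]|x [b Sb]].
  rewrite arc_between_segment// => /(segment_trans a)[|]; last by exists c.
  by rewrite segmentC; exists b.
by exists a => //; exists b => //; rewrite arc_between_segment.
Qed.

Lemma hull_closed (S : set X) : closed S -> closed (convex_hull S).
Proof.
move=> cS; have [[a Sa]|nS] := EM (S !=set0); last first.
  rewrite (_ : convex_hull S = set0); first exact: closed0.
  by apply/seteqP; split=> // x [b Sb]; case: nS; exists b.
rewrite (hull_from Sa).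
(* With one end fixed at [a], the hull is the projection of a compact set of pairs. *)
rewrite (_ : \bigcup_(b in S) _ =
    fst @` ([set wb : X * X | segment a wb.2 wb.1] `&` snd @^-1` S)).
  apply: compact_closed; first exact: metric_hausdorff.
  apply: continuous_compact.
    by apply: continuous_subspaceT => ?; exact: cvg_fst.
  apply: (subclosed_compact _ (compact_setX cX cX)) => //.
  apply: closedI; first exact: closed_segment_relation.
  by apply: preimage_closed => // ? _; exact: cvg_snd.
apply/seteqP; split=> [x [b Sb abx]|x [[w b] [/= abw Sb] <-]]; last by exists b.
by exists (x, b).
Qed.

Lemma hull_convex (S : set X) x y : convex_hull S x -> convex_hull S y ->
  segment x y `<=` convex_hull S.
Proof.
move=> Sx; have [a Sa _] := Sx; move: Sx; rewrite (hull_from Sa) => -[b Sb abx] [c Sc acy].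
have cU : connected (segment a b `|` segment a c).
  apply: connectedU; [|exact: connected_segment|exact: connected_segment].
  by exists a; split; exact: segment_left.
by move=> z /(segment_sub cU)[||?|?]; [left|right|exists b|exists c].
Qed.

End dendrite_order.

(** * Omega-limit sets *)

Section omega_limits.
Context {X : topologicalType}.
Implicit Types (f g h : X -> X) (x y z : X).

Lemma omega_limitP g y z : omega_limit g y z <->
  forall B, nbhs z B -> forall n, exists2 k, (n <= k)%N & B (iter k g y).
Proof.
split=> [yz B zB n|H n _ B zB].
  by have [_ [[k nk <-] Bk]] := yz n I B zB; exists k.
by have [k nk Bk] := H B zB n; exists (iter k g y); split=> //; exists k.
Qed.

Lemma closed_omega_limit g y : closed (omega_limit g y).
Proof. by apply: closed_bigI => n _; exact: closed_closure. Qed.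

Lemma omega_limit_nonempty g y : compact [set: X] -> omega_limit g y !=set0.
Proof.
move=> cX; apply: nested_closed_nonempty => //.
- by move=> n; exact: closed_closure.
- by move=> n; exists (iter n g y); apply: subset_closure; exists n => /=.
- by move=> n; apply: closureS => _ [k /= nk <-]; exists k => //=; exact: ltnW.
Qed.

Lemma omega_limit_semiconj g (phi : X -> X) y z :
  continuous phi -> (forall x, phi (g x) = g (phi x)) ->
  omega_limit g y z -> omega_limit g (phi y) (phi z).
Proof.
move=> cphi phig /omega_limitP yz; apply/omega_limitP => B zB n.
have [k nk Bk] := yz _ (cphi z B zB) n; exists k => //.
have phik j x : phi (iter j g x) = iter j g (phi x).
  by elim: j => //= j IH; rewrite phig IH.
by rewrite -phik.
Qed.

Lemma omega_limit_shift g y : omega_limit g (g y) `<=` omega_limit g y.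
Proof.
move=> z /omega_limitP yz; apply/omega_limitP => B zB n.
by have [k nk] := yz B zB n; rewrite -iterSr; exists k.+1 => //; exact: ltnW.
Qed.

Lemma iter_muln k j i f x :
  iter j (iter k f) (iter i f x) = iter (j * k + i) f x.
Proof. by rewrite -iterM -iterD. Qed.

Lemma omega_limit_iter_sub f x k i : (0 < k)%N ->
  omega_limit (iter k f) (iter i f x) `<=` omega_limit f x.
Proof.
move=> k0 z /omega_limitP yz; apply/omega_limitP => B zB n.
have [j nj] := yz B zB n; rewrite iter_muln; exists (j * k + i)%N => //.
by rewrite (leq_trans nj)// (leq_trans (leq_pmulr _ k0))// leq_addr.
Qed.

(** The visits near [z] are infinitely many, so some residue class modulo [k] contains infinitely
    many of them, for all neighbourhoods at once. *)
Lemma omega_limit_iter_cover f x k z : (0 < k)%N -> omega_limit f x z ->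
  exists2 i, (i < k)%N & omega_limit (iter k f) (iter i f x) z.
Proof.
move=> k0 /omega_limitP xz; apply: contrapT => H.
have /choice[Bn HBn] (i : 'I_k) : exists Bn : set X * nat, nbhs z Bn.1 /\
    forall j, (Bn.2 <= j)%N -> ~ Bn.1 (iter (j * k + i) f x).
  have /omega_limitP : ~ omega_limit (iter k f) (iter i f x) z.
    by move=> iz; apply: H; exists i.
  move=> /existsNP[B /not_implyP[zB /existsNP[n nB]]]; exists (B, n); split=> //= j nj.
  by move=> Bj; apply: nB; exists j => //; rewrite iter_muln.
have zB : \forall w \near z, forall i, (Bn i).1 w.
  by apply: filter_forall => i; have [] := HBn i.
have [t nt Bt] := xz _ zB (k * \max_i (Bn i).2)%N.
have tk : (t %% k < k)%N by rewrite ltn_pmod.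
have [_] := HBn (Ordinal tk); move=> /(_ (t %/ k)%N); apply.
  rewrite leq_divRL// (leq_trans _ nt)// mulnC leq_mul2l.
  by rewrite (leq_bigmax (Ordinal tk)) orbT.
by rewrite /= -divn_eq; exact: Bt.
Qed.

(** The orbit visits [S] at arbitrarily late times. Forward invariance keeps it in [S] after one
    visit; backward invariance carries late visits back to all earlier times. *)
Lemma omega_limit_invariant_sub g y z (S : set X) : closed S ->
  omega_limit g y z -> nbhs z S ->
  (forall x, S x -> S (g x)) \/ (forall x, S (g x) -> S x) ->
  omega_limit g y `<=` S.
Proof.
move=> cS /omega_limitP yz zS inv w /omega_limitP yw.
have {}inv : exists n, forall k, (n <= k)%N -> S (iter k g y).
  case: inv => inv.
    have [n _ Sn] := yz S zS 0%N; exists n => k /subnK <-.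
    by elim: (k - n)%N => [//|j IH]; rewrite addSn /=; exact: inv.
  exists 0%N => k _; have [n kn] := yz S zS k; rewrite -(subnK kn).
  by elim: (n - k)%N => [//|j IH]; rewrite addSn /= => /inv.
have [n Sn] := inv; apply: cS => B wB.
by have [k nk Bk] := yw B wB n; exists (iter k g y); split=> //; exact: Sn.
Qed.

Lemma monotone_map_iter f k : monotone_map f -> monotone_map (iter k f).
Proof.
move=> mf; elim: k => [//|k IH] C cC.
by rewrite (_ : _ @^-1` _ = iter k f @^-1` (f @^-1` C))//; exact/IH/mf.
Qed.

Lemma continuous_iter f k : continuous f -> continuous (iter k f).
Proof.
move=> cf; elim: k => [|k IH] x; first exact: cvg_id.
by apply: (@continuous_comp _ _ _ (iter k f) f); [exact: IH|exact: cf].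
Qed.

Lemma periodic_orbit_closed f p n : hausdorff_space X ->
  (0 < n)%N -> iter n f p = p -> closed [set iter k f p | k in setT].
Proof.
move=> hX n0 np; apply: compact_closed => //; apply: finite_compact.
apply: (@sub_finite_set _ _ ((fun k => iter k f p) @` `I_n)).
  move=> _ [k _ <-]; exists (k %% n)%N; first by rewrite /= ltn_pmod.
  rewrite [in RHS](divn_eq k n) addnC iterD iterM.
  by congr iter; elim: (k %/ n)%N => [//|j IH]; rewrite iterSr np.
exact: finite_image.
Qed.

End omega_limits.

(** * Omega-limit sets of iterates of a monotone dendrite map *)

Section monotone_dendrite_maps.
Context {R : realType} {X : metricType R}.
Hypothesis dX : dendrite X.
Variable f : X -> X.
Hypothesis cf : continuous f.
Hypothesis mf : monotone_map f.
Variable x : X.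

Let cX : compact [set: X]. Proof. exact: dendrite_compact. Qed.
Let lcX : locally_connected_space X. Proof. by case: dX. Qed.

Let omega k i := omega_limit (iter k f) (iter i f x).

(* A point [v] between [p] and [a], and not between [p] and [b], would have an
   invariant shadow, containing all the omega-limits whose index [n] is large
   as soon as it contains [A n]; so [b] would be in that shadow. *)
Lemma factorial_omega_limits_cluster (p a b : X) (A B : nat -> X) (I : nat -> nat) :
  f p = p -> (forall n, omega n`! (I n) (A n)) -> (forall n, omega n`! (I n) (B n)) ->
  (forall U V, nbhs a U -> nbhs b V -> forall N, exists n,
    [/\ (N <= n)%N, U (A n) & V (B n)]) ->
  segment p b a.
Proof.
move=> fp oA oB clab; apply: contrapT => npba.
have ap : a <> p by move=> e; apply: npba; rewrite e; exact: segment_left.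
have oN : nbhs a (~` segment p b).
  by apply: open_nbhs_nbhs; split=> //; apply: closed_openC; exact: closed_segment.
have [v [pav npbv va]] := connected_nonisolated (connected_segment dX p a)
  (segment_right p a) (segment_left p a) ap oN.
pose S := shadow p v.
have aS : nbhs a (interior S) by apply: nbhs_interior; exact: shadow_nbhs.
have cS : closed S by exact: shadow_closed.
have bS : nbhs b (~` S) by apply: open_nbhs_nbhs; split=> //; exact: closed_openC.
have Sint n : interior S (A n) -> nbhs (A n) S by [].
(* Two visits of one orbit to the shadow, at distinct times, provide the step [k] of the
   invariance. *)
have [t [k [k0 St Stk]]] : exists t k, [/\ (0 < k)%N, S (iter t f x) &
    S (iter k f (iter t f x))].
  have [n [_ /Sint AS _]] := clab _ _ aS bS 0%N.
  have /omega_limitP oAn := oA n.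
  have [j _ Sj] := oAn S AS 0%N; have [j' jj' Sj'] := oAn S AS j.+1.
  rewrite !iter_muln in Sj Sj'.
  exists (j * n`! + I n)%N, ((j' - j) * n`!)%N; split=> //.
    by rewrite muln_gt0 subn_gt0 jj' fact_gt0.
  by rewrite -iterD addnA -mulnDl subnK// ltnW.
have hp m : iter m f p = p by elim: m => //= m ->.
have mk : monotone_map (iter k f) by exact: monotone_map_iter.
have inv := shadow_invariant dX mk (hp k)
  (ex_intro2 _ _ _ St Stk).
have [n [kn /Sint AS BS]] := clab _ _ aS bS k.
(* For [n >= k], [k] divides [n]![, so that the iterate of order]n[!] is a power of [iter k f] and
   inherits the invariance. *)
have [m nm] : exists m, n`! = (m * k)%N.
  by exists (n`! %/ k)%N; rewrite divnK// dvdn_fact// k0.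
apply: BS; apply: omega_limit_invariant_sub cS (oA n) AS _ _ (oB n).
rewrite nm; case: inv => inv; [left|right] => y; rewrite iterM.
  by elim: m {nm} => [//|m IH] Sy /=; apply: inv; exact: IH.
by elim: m {nm} => [//|m IH] /= /inv/IH.
Qed.

Lemma factorial_omega_limits_small (e : R) : 0 < e ->
  exists2 k, (0 < k)%N & forall i a b, omega k i a -> omega k i b ->
    exists C, [/\ connected C, C a, C b &
      forall y z, C y -> C z -> mdist y z <= e].
Proof.
move=> e0; apply: contrapT => H.
have /choice[s Hs] n : exists s : nat * (X * X),
    [/\ omega n`! s.1 s.2.1, omega n`! s.1 s.2.2 &
     forall C, connected C -> C s.2.1 -> C s.2.2 ->
       ~ forall y z, C y -> C z -> mdist y z <= e].
  apply: contrapT => nS; apply: H; exists n`!; first exact: fact_gt0.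
  move=> i a b oa ob; apply: contrapT => nC; apply: nS; exists (i, (a, b)).
  by split=> // C cC Ca Cb Ce; apply: nC; exists C.
have [[a b] [_ clab]] : ([set: X] `*` [set: X]) `&`
    cluster ((fun n => (s n).2) @ \oo) !=set0.
  by apply: (compact_setX cX cX); near=> n.
have {}clab U V : nbhs a U -> nbhs b V -> forall N, exists n,
    [/\ (N <= n)%N, U (s n).2.1 & V (s n).2.2].
  move=> aU bV N; have abUV : nbhs (a, b) (U `*` V) by exists (U, V).
  have [|_ [[n Nn <-] [Un Vn]]] := clab ((fun n => (s n).2) @` [set n | (N <= n)%N]) _ _ abUV.
    by exists N => // n /= Nn; exists n.
  by exists n.
have [p _ fp] : exists2 p, [set: X] p & f p = p.
  by apply: (dendrite_fixed_point dX) => //; exists x.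
have oA n : omega n`! (s n).1 (s n).2.1 by have [] := Hs n.
have oB n : omega n`! (s n).1 (s n).2.2 by have [] := Hs n.
have pba := factorial_omega_limits_cluster fp oA oB clab.
have pab : segment p a b.
  apply: (factorial_omega_limits_cluster fp oB oA) => U V bU aV N.
  by have [n [? ? ?]] := clab V U aV bU N; exists n.
have ab : a = b by apply/esym; exact: (segment_antisym dX pba pab).
have [V [oV cV Va _ Ve]] := small_connected_nbhs lcX openT (Logic.I : [set: X] a) e0.
have aV : nbhs a V by exact: open_nbhs_nbhs.
have [|n [_ V1 V2]] := clab V V aV _ 0%N; first by rewrite -ab.
by have [_ _ /(_ V cV V1 V2)] := Hs n; exact.
Unshelve. all: by end_near. Qed.

(** A fixed point [p] of [iter k f] lies between two points [a] and [b] of [omega k 0]. By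
    monotonicity, [iter i f p] stays between their [i]-th images, which are in the small set
    [omega k i]; these sets cover the omega-limit set. *)
Lemma periodic_orbit_near_omega_limit (e : R) : 0 < e ->
  exists P, [/\ P !=set0 /\ closed P, periodic_orbit f P,
    P `<=` convex_hull (omega_limit f x) &
    hausdorff_dist (omega_limit f x) P <= e].
Proof.
move=> e0; have e2 : 0 < e / 2 by rewrite divr_gt0.
have [k k0 Hk] := factorial_omega_limits_small e2.
have oi i j y : omega k i y -> omega k (j + i) (iter j f y).
  rewrite /omega iterD => oy; apply: omega_limit_semiconj oy.
    exact: continuous_iter.
  by move=> z; rewrite -!iterD addnC.
have [a0 oa0] : omega k 0 !=set0 by exact: omega_limit_nonempty.
have [p [a oa [b ob abp]] pk] : exists2 p, convex_hull (omega k 0) p & iter k f p = p.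
  apply: (dendrite_fixed_point dX).
  - by apply: (hull_closed dX); exact: closed_omega_limit.
  - by exists a0, a0 => //; exists a0 => //; rewrite arc_between_segment//; exact: segment_left.
  - by move=> y z; exact: hull_convex.
  - exact: continuous_iter.
  - move=> y [c oc [d od]]; rewrite arc_between_segment// => cdy.
    (* As [iter k f] preserves [omega k 0] and maps segments into segments, it preserves the
       hull. *)
    have ok z : omega k 0 z -> omega k 0 (iter k f z).
      move=> oz; apply: omega_limit_shift; apply: omega_limit_semiconj oz => //.
      exact: continuous_iter.
    exists (iter k f c); first exact: ok.
    exists (iter k f d); first exact: ok.
    rewrite arc_between_segment//; apply: segment_monotone cdy => //.
    exact: monotone_map_iter.
rewrite arc_between_segment// in abp.
have segi i : segment (iter i f a) (iter i f b) (iter i f p).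
  by apply: segment_monotone abp => //; exact: monotone_map_iter.
have oa_i i : omega k i (iter i f a) by have := oi _ i _ oa; rewrite addn0.
have ob_i i : omega k i (iter i f b) by have := oi _ i _ ob; rewrite addn0.
have near_p i : mdist (iter i f p) (iter i f a) <= e / 2.
  have [C [cC Ca Cb Ce]] := Hk _ _ _ (oa_i i) (ob_i i).
  by apply: Ce => //; exact: (segment_sub cC Ca Cb (segi i)).
have oM i : omega k i `<=` omega_limit f x by exact: omega_limit_iter_sub.
exists [set iter i f p | i in setT]; split.
- split; first by exists p, 0%N.
  by apply: periodic_orbit_closed k0 pk; exact: metric_hausdorff.
- by exists p, k.
- move=> _ [i _ <-]; exists (iter i f a); first exact: oM (oa_i i).
  exists (iter i f b); first exact: oM (ob_i i).
  by rewrite arc_between_segment.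
apply: hausdorff_dist_le.
- exact: omega_limit_nonempty.
- by exists p, 0%N.
- move=> z /(omega_limit_iter_cover k0)[i _ oz].
  have [C [cC Ca Cz Ce]] := Hk _ _ _ (oa_i i) oz.
  apply: le_trans (dist_set_le z (_ : _ (iter i f p))) _; first by exists i.
  apply: le_trans (metric_triangle _ (iter i f a) _) _; rewrite [leRHS]splitr.
  by apply: lerD; [exact: Ce|rewrite metric_sym].
- move=> _ [i _ <-]; apply: le_trans (dist_set_le _ (oM i _ (oa_i i))) _.
  by apply: le_trans (near_p i) _; rewrite ler_pdivrMr// ler_pMr// ler1n.
Qed.

End monotone_dendrite_maps.

Theorem theorem4p4 (R : realType) (X : metricType R) (dX : dendrite X)
    (f : X -> X) (M : set X) :
  continuous f -> monotone_map f ->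
  (exists x : X, M = omega_limit f x) ->
  exists2 K : hyperspace (dendrite_compact dX), hset K = M &
    closure [set P : hyperspace (dendrite_compact dX) |
              periodic_orbit f (hset P) /\ hset P `<=` convex_hull M] K.
Proof.
move=> cf mf [x ->].
have M0 : `[< omega_limit f x !=set0 /\ closed (omega_limit f x) >].
  apply/asboolP; split; last exact: closed_omega_limit.
  exact/omega_limit_nonempty/dendrite_compact.
exists (Hyperspace (dendrite_compact dX) M0) => // B /nbhs_ballP[e /= e0 eB].
(* Half of [e] turns the weak bound on the distance into membership in the open ball. *)
have e2 : 0 < e / 2 by rewrite divr_gt0.
have [P [P0 perP PM MP]] := periodic_orbit_near_omega_limit dX cf mf x e2.
exists (Hyperspace (dendrite_compact dX) (introT (asboolP _) P0)); split=> //.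
apply: eB; rewrite ballEmdist /=; apply: le_lt_trans MP _.
by rewrite ltr_pdivrMr// ltr_pMr// ltr1n.
Qed.
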